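(* Let $K=\{123,231\}\{213,312\}$ and let $f(n)$ be the number of equivalence classes of $S_n$ under $K$-equivalence. Define $g(n,k)$ for integers $n,k\ge 1$ recursively by $$g(n,k)=\begin{cases}1, & \text{if } n=1 \text{ or } n-2k+1=0,\\[4pt] \displaystyle\sum_{j=1}^{\lfloor (n+1)/2\rfloor} g(n-1,j), & \text{else if } k=1,\\[8pt] \displaystyle\sum_{x=k-1}^{n-k}\ \sum_{j=1}^{n-k-x}\binom{x-1}{k-2}\, g(n-2k+1,j), & \text{otherwise.}\end{cases}$$ Then for all integers $n\ge 3$, $$f(n)=\sum_{k=1}^{\lfloor n/2+1\rfloor} g(n+1,k)+n-2.$$
   Context: Permutations in $S_n$ are written as words $\pi_1\pi_2\cdots\pi_n$ in one-line notation. The order permutation of a word $u$ of $c$ distinct positive integers is the unique $\sigma\in S_c$ with $\sigma_i<\sigma_j$ iff $u_i<u_j$. A replacement partition $K$ of $S_c$ is a set partition of $S_c$; it is denoted by listing its parts with the one-element parts (and outer brackets) omitted, so here $K$ is the set partition of $S_3$ whose only parts of size greater than one are $\{123,231\}$ and $\{213,312\}$. The $K$-equivalence on $S_n$ is the equivalence relation generated by: $\phi\equiv\psi$ whenever $\phi=aub$ and $\psi=avb$ (concatenations) for some possibly empty words $a,b$ and words $u,v$ of length $c$ (so $u,v$ occupy the same $c$ consecutive positions) such that the order permutations of $u$ and $v$ lie in the same part of $K$. All equivalence classes are counted, including one-element classes. Sums over empty ranges are $0$. *)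

(* Defs.v *)
From mathcomp Require Import all_boot all_fingroup.

Set Implicit Arguments.
Unset Strict Implicit.
Unset Printing Implicit Defensive.

(* One-line notation. ['S_n] permutes {0, ..., n-1}; letters are shifted by one
   so that words are on the alphabet {1, ..., n}. *)
Definition word (n : nat) (s : 'S_n) : seq nat := [seq (s i).+1 | i <- enum 'I_n].

Definition is_order_perm (c : nat) (u : seq nat) (sigma : 'S_c) : bool :=
  [&& size u == c, uniq u &
    [forall i : 'I_c, forall j : 'I_c,
      (sigma i < sigma j) == (nth 0 u i < nth 0 u j)]].

Section KEquivalence.

Variables (c : nat) (K : {set {set 'S_c}}) (n : nat).

Definition same_part (u v : seq nat) : bool :=
  [exists B in K, exists sigma in B, exists tau in B,
    is_order_perm u sigma && is_order_perm v tau].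

(* Boolean form of a single replacement; see [K_stepP] for phi = aub, psi = avb. *)
Definition K_step : rel 'S_n := fun phi psi =>
  [exists i : 'I_n.+1,
    [&& take i (word phi) == take i (word psi),
        drop (i + c) (word phi) == drop (i + c) (word psi) &
        same_part (take c (drop i (word phi))) (take c (drop i (word psi)))]].

(* [K_step] is symmetric ([K_step_sym]), so its reflexive transitive closure is
   the equivalence relation it generates. *)
Definition K_equiv : rel 'S_n := connect K_step.

Definition num_K_classes : nat :=
  #|equivalence_partition K_equiv [set: 'S_n]|.

Lemma size_word (s : 'S_n) : size (word s) = n.
Proof. by rewrite size_map size_enum_ord. Qed.

Lemma same_part_sym : symmetric same_part.
Proof.
suff H u v : same_part u v -> same_part v u by move=> u v; apply/idP/idP; apply: H.
case/existsP=> B /andP[BK /existsP[s /andP[sB /existsP[t /and3P[tB us vt]]]]].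
apply/existsP; exists B; rewrite BK; apply/existsP; exists t; rewrite tB.
by apply/existsP; exists s; rewrite sB vt us.
Qed.

Lemma same_part_size u v : same_part u v -> size u = c /\ size v = c.
Proof.
case/existsP=> B /andP[_ /existsP[s /andP[_ /existsP[t /and3P[_]]]]].
by case/and3P=> /eqP-> _ _ /and3P[/eqP-> _ _].
Qed.

Lemma K_stepP (phi psi : 'S_n) :
  reflect (exists a u v b : seq nat,
             [/\ word phi = a ++ u ++ b, word psi = a ++ v ++ b,
                 size u = c, size v = c & same_part u v])
          (K_step phi psi).
Proof.
apply: (iffP existsP) => [[i /and3P[/eqP tE /eqP dE sp]] | [a [u [v [b]]]]].
  exists (take i (word phi)), (take c (drop i (word phi))).
  exists (take c (drop i (word psi))), (drop (i + c) (word phi)).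
  have [su sv] := same_part_size sp; split=> //.
    by rewrite addnC -drop_drop cat_take_drop cat_take_drop.
  by rewrite tE dE addnC -drop_drop cat_take_drop cat_take_drop.
case=> ephi epsi su sv sp.
have lt_a : size a < n.+1.
  by rewrite ltnS -(size_word phi) ephi size_cat leq_addr.
exists (Ordinal lt_a) => /=; rewrite ephi epsi.
rewrite !take_size_cat // eqxx /= ![_ + c]addnC -!drop_drop !drop_size_cat //.
by rewrite !take_size_cat // eqxx.
Qed.

Lemma K_step_sym : symmetric K_step.
Proof.
move=> phi psi; apply: eq_existsb => i.
by rewrite eq_sym [drop _ _ == _]eq_sym same_part_sym.
Qed.

Lemma K_equiv_equivalence : equivalence_rel K_equiv.
Proof.
apply/equivalence_relP; split=> [x | x y xy]; first exact: connect0.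
exact: same_connect (sym_connect_sym K_step_sym) _ _ xy.
Qed.

End KEquivalence.

Definition perms_of_words (c : nat) (l : seq (seq nat)) : {set 'S_c} :=
  [set s : 'S_c | word s \in l].

(* The replacement partition {123,231}{213,312}, one-element parts included. *)
Definition K_123_231_213_312 : {set {set 'S_3}} :=
  [set perms_of_words 3 [:: [:: 1; 2; 3]; [:: 2; 3; 1]];
       perms_of_words 3 [:: [:: 2; 1; 3]; [:: 3; 1; 2]];
       perms_of_words 3 [:: [:: 1; 3; 2]];
       perms_of_words 3 [:: [:: 3; 2; 1]]].

(* For n = n'.+1, [n' - (k.*2 - 2)] is n - 2k + 1, written so that the recursive
   call is structural; [gE] is the intended recursion. *)
Fixpoint g (n k : nat) : nat :=
  if n is n'.+1 then
    if (n == 1) || (n.+1 == k.*2) then 1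
    else if k == 1 then \sum_(1 <= j < (n.+1)./2.+1) g n' j
    else \sum_(k.-1 <= x < (n - k).+1) \sum_(1 <= j < (n - k - x).+1)
           'C(x.-1, k - 2) * g (n' - (k.*2 - 2)) j
  else 0.

Lemma gE (n k : nat) : 1 <= n -> 1 <= k ->
  g n k =
    if (n == 1) || (n + 1 == 2 * k) then 1
    else if k == 1 then \sum_(1 <= j < ((n + 1) %/ 2).+1) g (n - 1) j
    else \sum_(k - 1 <= x < (n - k).+1) \sum_(1 <= j < (n - k - x).+1)
           'C(x - 1, k - 2) * g (n + 1 - 2 * k) j.
Proof.
case: n => // n _ k_gt0; rewrite addn1 mul2n divn2 !subn1 /=.
case: ifP => // _; case: ifP => // /eqP k1.
apply: eq_bigr => x _; apply: eq_bigr => j _; rewrite subn1.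
suff -> : n.+2 - k.*2 = n - (k.*2 - 2) by [].
by case: k k_gt0 k1 => // k _ _; rewrite doubleS !subSS subn0.
Qed.

(* Main.v *)
Require Import Defs.
From mathcomp Require Import all_boot all_fingroup.
From mathcomp Require Import zify.

(** The two replacements act on three consecutive letters: a rotation
    [abc <-> bca] of letters [a < b < c], and a swap [bac <-> cab] of the two
    neighbours of a local minimum [a].  The classes are counted by exhibiting
    one representative of each; they are of two kinds.

    Classes with a rotatable window (some member contains consecutive letters
    ordered like 123 or 231).  There are [n - 2] of them.  For a parity [e] and
    a set [s] of smallest letters, call a word aligned when the letters of [s]
    occur in increasing order, all at positions of parity [e].  Both
    replacements preserve alignment ([aligned_eqv]).  Write [s_1 < ... < s_n]
    for the letters.  Every word with a rotatable window is equivalent to one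
    of the words [s_1 s_n s_2 s_(n-1) ... s_k s_(n-k+1)] followed by at least
    three remaining letters in increasing order, or to a word of this shape on
    the letters other than the largest, preceded by the largest one
    ([rot_canonical]).  This is an induction on the length: the rotatable window
    can be carried along the word so as to bring the least letter to the first
    or second place while keeping a rotatable window behind it
    ([rot_normalize]), which only requires looking at words of length 4 and 5.
    The canonical words are told apart by alignment ([canon_inj]).

    Classes without rotatable window.  Here only swaps apply.  Put a largest
    letter in front of such a word, and cut the result into blocks
    [p_1 v_1 p_2 v_2 ... v_(k-1) p_k] alternating between peaks and valleys.
    Absence of rotations throughout the class means that the valleys of a block
    increase, that its peaks exceed every later letter, and that its valleys lie
    below its own peaks and below the peaks of the next block
    ([rot_free_valid_top], [valid_rot_free]).  Swaps permute the peaks of a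
    block and change nothing else, so the list of blocks with sorted peaks is a
    complete invariant ([blocks_move], [eqv_unparse]).  The valid lists of
    blocks on [1, ..., m] are produced by placing the largest letter in front
    either as a block of its own, or together with a valley that lies below the
    first block and below the peaks of the second.  Counting them by the number
    [k] of peaks of the first block gives [g m k] ([num_lists_g]): the binomial
    coefficient chooses the valleys below the largest one, and the inner sum
    says that the [j] peaks of the second block lie above that valley. *)

Set Implicit Arguments.
Unset Strict Implicit.
Unset Printing Implicit Defensive.

(** * Words up to rotations and swaps *)

(** One replacement, read in the increasing direction for rotations; a swap is
    its own inverse up to exchanging the names of [b] and [c]. *)
Inductive move : seq nat -> seq nat -> Prop :=
| MoveRot a b c w of a < b & b < c :
    move [:: a, b, c & w] [:: b, c, a & w]
| MoveSwap a b c w of a < b & a < c :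
    move [:: b, a, c & w] [:: c, a, b & w]
| MoveCons x w1 w2 of move w1 w2 : move (x :: w1) (x :: w2).

(** The equivalence relation generated by [move]. *)
Inductive eqv : seq nat -> seq nat -> Prop :=
| EqvRefl w : eqv w w
| EqvFwd w1 w2 w3 of move w1 w2 & eqv w2 w3 : eqv w1 w3
| EqvBwd w1 w2 w3 of move w2 w1 & eqv w2 w3 : eqv w1 w3.

Lemma move_eqv w1 w2 : move w1 w2 -> eqv w1 w2.
Proof. by move=> h; apply: EqvFwd h (EqvRefl _). Qed.

Lemma eqv_trans w2 w1 w3 : eqv w1 w2 -> eqv w2 w3 -> eqv w1 w3.
Proof.
by elim=> // u v w uv _ IH /IH; [apply: EqvFwd | apply: EqvBwd].
Qed.

Lemma eqv_sym w1 w2 : eqv w1 w2 -> eqv w2 w1.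
Proof.
elim=> [w | u v w uv _ IH | u v w uv _ IH]; first exact: EqvRefl.
- by apply: eqv_trans IH _; apply: EqvBwd uv (EqvRefl _).
- by apply: eqv_trans IH _; apply: move_eqv.
Qed.

(** A property stable under a replacement in either direction is a class
    invariant. *)
Lemma eqv_invariant (P : seq nat -> Prop) :
    (forall u v, move u v \/ move v u -> P u -> P v) ->
  forall w1 w2, eqv w1 w2 -> P w1 -> P w2.
Proof.
by move=> H w1 w2; elim=> // u v w uv _ IH Pu; apply/IH/(H u) => //; [left | right].
Qed.

Lemma eqv_cons x w1 w2 : eqv w1 w2 -> eqv (x :: w1) (x :: w2).
Proof.
elim=> [w | u v w uv _ IH | u v w uv _ IH]; first exact: EqvRefl.
- exact: EqvFwd (MoveCons x uv) IH.
- exact: EqvBwd (MoveCons x uv) IH.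
Qed.

Lemma move_catr s w1 w2 : move w1 w2 -> move (w1 ++ s) (w2 ++ s).
Proof. by elim=> *; constructor. Qed.

Lemma eqv_catr s w1 w2 : eqv w1 w2 -> eqv (w1 ++ s) (w2 ++ s).
Proof.
elim=> [w | u v w uv _ IH | u v w uv _ IH]; first exact: EqvRefl.
- exact: EqvFwd (move_catr s uv) IH.
- exact: EqvBwd (move_catr s uv) IH.
Qed.

Lemma eqv_rot a b c w : a < b -> b < c -> eqv [:: a, b, c & w] [:: b, c, a & w].
Proof. by move=> *; apply/move_eqv/MoveRot. Qed.

Lemma eqv_swap a b c w : a < b -> a < c -> eqv [:: b, a, c & w] [:: c, a, b & w].
Proof. by move=> *; apply/move_eqv/MoveSwap. Qed.

Lemma move_perm w1 w2 : move w1 w2 -> perm_eq w1 w2.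
Proof.
elim=> [a b c w _ _ | a b c w _ _ | x u v _ uv]; last by rewrite perm_cons.
  by apply/seq.permP=> P /=; lia.
by apply/seq.permP=> P /=; lia.
Qed.

Lemma eqv_perm w1 w2 : eqv w1 w2 -> perm_eq w1 w2.
Proof.
elim=> // u v w uv _ /(perm_trans _) -> //; first exact: move_perm.
by rewrite perm_sym; apply: move_perm.
Qed.

Lemma move_map f w1 w2 : {homo f : x y / x < y} ->
  move w1 w2 -> move (map f w1) (map f w2).
Proof. by move=> fP; elim=> *; constructor; auto. Qed.

Lemma eqv_map f w1 w2 : {homo f : x y / x < y} ->
  eqv w1 w2 -> eqv (map f w1) (map f w2).
Proof.
move=> fP; elim=> [w | u v w uv _ IH | u v w uv _ IH]; first exact: EqvRefl.
- exact: EqvFwd (move_map fP uv) IH.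
- exact: EqvBwd (move_map fP uv) IH.
Qed.

(** The letters [a b c] are ordered like 123 or 231, so that a rotation
    applies. *)
Definition rot3 a b c := (a < b < c) || (c < a < b).

(** Some window of three consecutive letters of [w] can be rotated. *)
Fixpoint has_rot w :=
  if w is a :: w' then
    (if w' is [:: b, c & _] then rot3 a b c else false) || has_rot w'
  else false.

(** * Words of length 4 and 5 *)

(** The words one replacement away from [w]. *)
Fixpoint nexts w : seq (seq nat) :=
  if w is a :: w' then
    (if w' is [:: b, c & s] then
       if a < b < c then [:: [:: b, c, a & s]]
       else if c < a < b then [:: [:: c, a, b & s]]
       else if (b < a) && (b < c) then [:: [:: c, b, a & s]]
       else [::]
     else [::]) ++ [seq a :: v | v <- nexts w']
  else [::].

Lemma nexts_eqv w v : v \in nexts w -> eqv w v.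
Proof.
elim: w v => //= a w IH v; rewrite mem_cat => /orP[|/mapP[u /IH uv ->]]; last first.
  exact: eqv_cons.
case: w {IH} => [|b [|c s]] //.
case: ifP => [/andP[ab bc]|_]; first by rewrite inE => /eqP->; apply: eqv_rot.
case: ifP => [/andP[ca ab]|_].
  by rewrite inE => /eqP->; apply/eqv_sym/eqv_rot.
by case: ifP => // /andP[ab bc]; rewrite inE => /eqP->; apply: eqv_swap.
Qed.

(** The words at most [k] replacements away from [w]. *)
Definition reach k w : seq (seq nat) :=
  iter k (fun l => undup (l ++ flatten [seq nexts v | v <- l])) [:: w].

Lemma reach_eqv k w v : v \in reach k w -> eqv w v.
Proof.
elim: k v => [|k IH] v /=; first by rewrite inE => /eqP->; constructor.
rewrite mem_undup mem_cat => /orP[/IH //|/flatten_mapP[u /IH wu /nexts_eqv]].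
exact: eqv_trans.
Qed.

(** A word with distinct letters is an increasing relabelling of a permutation
    of [0, ..., k-1].  The relabelling is extended beyond [k] so as to be
    increasing on all of [nat]. *)
Lemma standardize w : uniq w -> exists f u,
  [/\ {homo f : x y / x < y}, u \in permutations (iota 0 (size w)) & w = map f u].
Proof.
move=> uw; pose s := sort leq w.
have us : uniq s by rewrite sort_uniq.
have ss : size s = size w by rewrite size_sort.
have st : sorted ltn s by rewrite ltn_sorted_uniq_leq us sort_sorted //; apply: leq_total.
pose f i := if i < size w then nth 0 s i else i + \max_(x <- w) x.+1.
have bnd i : i < size w -> nth 0 s i < \max_(x <- w) x.+1.
  move=> lt_i; apply: (@leq_bigmax_seq _ w xpredT (fun x => x.+1) (nth 0 s i)) => //.
  by rewrite -(mem_sort leq); apply: mem_nth; rewrite ss.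
exists f, [seq index x s | x <- w]; split.
- move=> i j lt_ij; rewrite /f; case: ifPn => hi; case: ifPn => hj; try lia.
    by apply: (sorted_ltn_nth ltn_trans) => //; rewrite inE ss.
  by have := bnd i hi; lia.
- have ui : uniq [seq index x s | x <- w].
    rewrite map_inj_in_uniq // => x y xw yw e.
    by rewrite -(nth_index 0 (_ : x \in s)) ?mem_sort // e nth_index ?mem_sort.
  have sub : {subset [seq index x s | x <- w] <= iota 0 (size w)}.
    by move=> _ /mapP[x xw ->]; rewrite mem_iota /= -ss index_mem mem_sort.
  rewrite mem_permutations; apply: uniq_perm => //; first exact: iota_uniq.
  by have [] := uniq_min_size ui sub; rewrite ?size_map ?size_iota.
rewrite -map_comp -[LHS]map_id; apply/eq_in_map => x xw /=.
have xs : x \in s by rewrite mem_sort.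
by rewrite /f -ss index_mem xs nth_index.
Qed.

(** A claim of the form: every word of length [k] with property [P] is equivalent
    to one with property [Q], where both properties depend only on the relative
    order of the letters, reduces to a search among the permutations of
    [0, ..., k-1]. *)
Lemma window_check k d (P Q : pred (seq nat)) :
    (forall f u, {homo f : x y / x < y} -> P (map f u) = P u) ->
    (forall f u, {homo f : x y / x < y} -> Q (map f u) = Q u) ->
    all (fun u => P u ==> has Q (reach d u)) (permutations (iota 0 k)) ->
  forall w, uniq w -> size w = k -> P w -> exists2 v, eqv w v & Q v.
Proof.
move=> Pf Qf /allP chk w uw sw Pw.
have [f [u [fP uP ew]]] := standardize uw; rewrite sw in uP.
have := chk u uP; rewrite -(Pf f) // -ew Pw => /hasP[v uv Qv].
exists (map f v); last by rewrite Qf.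
by rewrite ew; apply: eqv_map fP _; apply: reach_eqv uv.
Qed.

Lemma homo_ltnE f : {homo f : x y / x < y} -> {mono f : x y / x < y}.
Proof. by move=> fP; apply/leqW_mono/leq_mono. Qed.

Lemma rot3_map f a b c : {homo f : x y / x < y} -> rot3 (f a) (f b) (f c) = rot3 a b c.
Proof. by move=> /homo_ltnE fP; rewrite /rot3 !fP. Qed.

Lemma has_rot_map f u : {homo f : x y / x < y} -> has_rot (map f u) = has_rot u.
Proof.
move=> fP; elim: u => //= a u ->; case: u => [|b [|c u]] //=.
by rewrite rot3_map.
Qed.

(** The first window can be rotated. *)
Definition rot_head w := if w is [:: a, b, c & _] then rot3 a b c else false.

Lemma rot_head_map f u : {homo f : x y / x < y} -> rot_head (map f u) = rot_head u.
Proof. by move=> fP; case: u => [|a [|b [|c u]]] //=; rewrite rot3_map. Qed.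

(** The least letter comes first, second, or third. *)
Definition min_head w := if w is m :: t then all (leq m) t else false.

Lemma min_head_map f u : {homo f : x y / x < y} -> min_head (map f u) = min_head u.
Proof.
by move=> /leq_mono fP; case: u => //= a u; rewrite all_map; apply: eq_all => x /=; rewrite fP.
Qed.

Definition min_snd w := if w is [:: x, m & t] then all (leq m) (x :: t) else false.

Lemma min_snd_map f u : {homo f : x y / x < y} -> min_snd (map f u) = min_snd u.
Proof.
move=> /leq_mono fP; case: u => [|a [|b u]] //=; rewrite fP all_map; congr (_ && _).
by apply: eq_all => x /=; rewrite fP.
Qed.

Definition min_third w := if w is [:: x, y, m & t] then all (leq m) [:: x, y & t] else false.

Lemma min_third_map f u : {homo f : x y / x < y} -> min_third (map f u) = min_third u.
Proof.
move=> /leq_mono fP; case: u => [|a [|b [|c u]]] //=; rewrite !fP all_map; do 2 congr (_ && _).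
by apply: eq_all => x /=; rewrite fP.
Qed.

(** The five finite checks.  The search depths 8 and 12 are large enough for the
    classes of words of length 4 and 5. *)
Lemma window4_left w : uniq w -> size w = 4 -> rot_head (behead w) ->
  exists2 v, eqv w v & rot_head v.
Proof.
move=> uw sw bw;
  apply: (@window_check 4 8 (fun w => rot_head (behead w)) rot_head _ _ _ w uw sw bw).
- by move=> f u fP; rewrite behead_map rot_head_map.
- exact: rot_head_map.
- vm_compute; reflexivity.
Qed.

Lemma window4_right w : uniq w -> size w = 4 -> rot_head w ->
  exists2 v, eqv w v & rot_head (behead v).
Proof.
move=> uw sw bw;
  apply: (@window_check 4 8 rot_head (fun w => rot_head (behead w)) _ _ _ w uw sw bw).
- exact: rot_head_map.
- by move=> f u fP; rewrite behead_map rot_head_map.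
- vm_compute; reflexivity.
Qed.

Lemma window4_min w : uniq w -> size w = 4 -> min_head w -> rot_head (behead w) ->
  exists2 v, eqv w v & min_head v && rot_head v.
Proof.
move=> uw sw mw bw.
apply: (@window_check 4 8 (fun w => min_head w && rot_head (behead w))
  (fun w => min_head w && rot_head w) _ _ _ w uw sw); last by rewrite mw.
- by move=> f u fP; rewrite behead_map rot_head_map ?min_head_map.
- by move=> f u fP; rewrite rot_head_map ?min_head_map.
- vm_compute; reflexivity.
Qed.

Lemma window4_base w : uniq w -> size w = 4 -> has_rot w ->
  exists2 v, eqv w v & has_rot (behead v) && (min_head v || min_snd v).
Proof.
move=> uw sw bw.
apply: (@window_check 4 8 has_rot
  (fun v => has_rot (behead v) && (min_head v || min_snd v)) _ _ _ w uw sw bw).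
- by move=> f u fP; rewrite has_rot_map.
- by move=> f u fP; rewrite behead_map has_rot_map ?min_head_map ?min_snd_map.
- vm_compute; reflexivity.
Qed.

Lemma window5_min w : uniq w -> size w = 5 -> min_third w -> rot_head (drop 2 w) ->
  exists2 v, eqv w v & min_head v && has_rot (behead v).
Proof.
move=> uw sw mw bw.
apply: (@window_check 5 12 (fun w => min_third w && rot_head (drop 2 w))
  (fun w => min_head w && has_rot (behead w)) _ _ _ w uw sw); last by rewrite mw.
- by move=> f u fP; rewrite -map_drop rot_head_map ?min_third_map.
- by move=> f u fP; rewrite behead_map has_rot_map ?min_head_map.
- vm_compute; reflexivity.
Qed.

(** * Bringing the least letter to the front *)

Lemma iota_rcons a m : iota a m.+1 = rcons (iota a m) (a + m).
Proof. by rewrite -addn1 iotaD cats1. Qed.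

Lemma eqv_uniq w1 w2 : eqv w1 w2 -> uniq w1 = uniq w2.
Proof. by move/eqv_perm/perm_uniq. Qed.

Lemma eqv_size w1 w2 : eqv w1 w2 -> size w1 = size w2.
Proof. by move/eqv_perm/perm_size. Qed.

Lemma eqv_mem w1 w2 : eqv w1 w2 -> w1 =i w2.
Proof. by move/eqv_perm/perm_mem. Qed.

Lemma has_rot_cons x w : has_rot (x :: w) = rot_head (x :: w) || has_rot w.
Proof. by case: w => [|b [|c w]]. Qed.

Lemma has_rot_consr x w : has_rot w -> has_rot (x :: w).
Proof. by rewrite has_rot_cons => ->; rewrite orbT. Qed.

Lemma has_rot_size w : has_rot w -> 2 < size w.
Proof.
elim: w => // a w IH; rewrite has_rot_cons => /orP[|/IH /=]; last by lia.
by case: w {IH} => [|b [|c w]].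
Qed.

Lemma rot_head_has_rot w : rot_head w -> has_rot w.
Proof. by case: w => // a w; rewrite has_rot_cons => ->. Qed.

Lemma rot_head_cat u v : 2 < size u -> rot_head (u ++ v) = rot_head u.
Proof. by case: u => [|a [|b [|c u]]]. Qed.

Lemma has_rot_catr u v : has_rot u -> has_rot (u ++ v).
Proof.
elim: u => // a u IH; rewrite cat_cons !has_rot_cons => /orP[h|/IH->]; last by rewrite orbT.
by rewrite -cat_cons rot_head_cat ?h //; case: u h {IH} => [|b [|c u]].
Qed.

Lemma has_rot_catl u v : has_rot v -> has_rot (u ++ v).
Proof. by elim: u => // a u IH /IH; apply: has_rot_consr. Qed.

(** A rotatable window can be carried to the left end of the word. *)
Lemma rot_to_head w : uniq w -> has_rot w -> exists2 v, eqv w v & rot_head v.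
Proof.
elim: w => // x w IH uxw; rewrite has_rot_cons => /orP[h|h].
  by exists (x :: w); [apply: EqvRefl |].
have [|v wv bv] := IH _ h; first by case/andP: uxw.
have exv := eqv_cons x wv.
have uxv : uniq (x :: v) by rewrite -(eqv_uniq exv).
case: v wv bv exv uxv => [|a [|b [|c s]]] // wv bv exv uxv.
have [||u eu bu] := @window4_left [:: x; a; b; c] _ _ bv => //.
  by have := take_uniq 4 uxv; rewrite /= take0.
exists (u ++ s); first exact: eqv_trans exv (eqv_catr s eu).
by rewrite rot_head_cat // -(eqv_size eu).
Qed.

(** A rotatable window can be found beyond the first letter. *)
Lemma rot_off_head w : uniq w -> 3 < size w -> has_rot w ->
  exists2 v, eqv w v & has_rot (behead v).
Proof.
case: w => // x w uw sw; rewrite has_rot_cons => /orP[h|h]; last first.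
  by exists (x :: w); [apply: EqvRefl |].
case: w uw sw h => [|a [|b [|c s]]] // uw sw h.
have [||u eu bu] := @window4_right [:: x; a; b; c] _ _ h => //.
  by have := take_uniq 4 uw; rewrite /= take0.
exists (u ++ s); first exact (eqv_catr s eu).
have : size u = 4 by rewrite -(eqv_size eu).
by case: u {eu} bu => //= y u bu su; apply/has_rot_catr/rot_head_has_rot.
Qed.

(** When the least letter comes first, a rotatable window can be carried onto
    it. *)
Lemma rot_to_min m t : uniq (m :: t) -> all (leq m) t -> has_rot (m :: t) ->
  exists a b s, eqv (m :: t) [:: m, a, b & s] /\ m < a < b.
Proof.
move=> ut mt h.
have {h} [v [ev mv bv]] : exists v, [/\ eqv (m :: t) v, min_head v & rot_head v].
  move: h; rewrite has_rot_cons => /orP[h|h].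
    by exists (m :: t); split=> //; apply: EqvRefl.
  have [|v tv bv] := rot_to_head _ h; first by case/andP: ut.
  have emv := eqv_cons m tv.
  have umv : uniq (m :: v) by rewrite -(eqv_uniq emv).
  have mv : all (leq m) v by rewrite -(perm_all _ (eqv_perm tv)).
  case: v tv bv emv umv mv => [|a [|b [|c s]]] // tv bv emv umv mv.
  have [|||u eu] := @window4_min [:: m; a; b; c] _ _ _ bv => //.
  - by have := take_uniq 4 umv; rewrite /= take0.
  - by move: mv => /=; rewrite andbT; case/and4P => -> -> ->.
  case/andP=> mu bu; exists (u ++ s); split.
  - exact: eqv_trans emv (eqv_catr s eu).
  - have pu := eqv_perm eu.
    case: u eu mu bu pu => // m' u eu mu bu pu; rewrite /= all_cat (mu : all _ _) /=.
    apply/allP=> x xs.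
    have /allP mle : all (leq m) [:: a, b, c & s] by [].
    apply: leq_trans (mle x _); last by rewrite !inE xs !orbT.
    have : m \in m' :: u by rewrite -(perm_mem pu) inE eqxx.
    by rewrite inE => /orP[/eqP->//|mu']; apply: (allP mu).
  - by rewrite rot_head_cat // -(eqv_size eu).
have mm : m \in v by rewrite -(eqv_mem ev) inE eqxx.
have uv : uniq v by rewrite -(eqv_uniq ev).
case: v ev mv bv mm uv => [|m' [|a [|b s]]] // ev mv bv mm uv.
have em : m' = m.
  apply/eqP; rewrite eqn_leq; apply/andP; split.
    by move: mm; rewrite inE => /orP[/eqP->//|/(allP mv)].
  have : m' \in m :: t by rewrite (eqv_mem ev) inE eqxx.
  by rewrite inE => /orP[/eqP->//|/(allP mt)].
subst m'; exists a, b, s; split=> //.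
by move: bv mv; rewrite /= /rot3; lia.
Qed.

(** Unless [x] is least, the inductive step leads to a word [x v] where [v] has
    its least letter first or second.  The only case where this does not conclude is
    [v = y m t] with [m] least: then the window is carried onto [m], and a word
    of length 5 whose third letter is least can be rearranged to start with it. *)
Lemma rot_normalize w : uniq w -> 3 < size w -> has_rot w ->
  exists2 v, eqv w v & has_rot (behead v) && (min_head v || min_snd v).
Proof.
elim: {w}(size w) {-2}w (erefl (size w)) => [|n IH] w sw uw; first by rewrite sw.
move=> n4 bw; have [n5|n5] := leqP (size w) 4.
  by apply: window4_base => //; apply/eqP; rewrite eqn_leq n5.
have [[|x w'] ev bw'] := rot_off_head uw n4 bw; first by [].
have uxw' : uniq (x :: w') by rewrite -(eqv_uniq ev).
have sxw : size (x :: w') = n.+1 by rewrite -(eqv_size ev) sw.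
have [mx|mx] := boolP (all (leq x) w').
  by exists (x :: w') => //; rewrite bw' /= mx.
have [|||u wu] := IH w' _ _ _ bw'.
- by case: sxw.
- by case/andP: uxw'.
- by move: sxw n5; rewrite sw /=; lia.
have xlt m : all (leq m) u -> m < x.
  move=> mu; rewrite ltnNge; apply: contra mx => le_xm.
  by rewrite (perm_all _ (eqv_perm wu)); apply: sub_all mu => y /(leq_trans le_xm).
have exu := eqv_trans ev (eqv_cons x wu).
have uxu : uniq (x :: u) by rewrite -(eqv_uniq exu).
case/andP=> bu /orP[mu|mu].
  exists (x :: u) => //=; case: u {wu exu uxu} bu mu xlt => //= m t bt mt xlt.
  have mx' : m < x by apply: xlt; rewrite /= leqnn.
  by rewrite mt (ltnW mx') /= orbT andbT; apply: (has_rot_consr m bt).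
case: u wu bu mu xlt exu uxu => [|y [|m t]] // wu bu mu xlt exu uxu.
have mt : all (leq m) t by case/andP: mu.
have my : m <= y by case/andP: mu.
have mx' : m < x by apply: xlt; rewrite /= my leqnn.
have [|a [b [s [es /andP[ma ab]]]]] := rot_to_min _ mt bu.
  by case/and3P: uxu.
have e1 := eqv_trans exu (eqv_cons x (eqv_cons y es)).
have u1 : uniq [:: x, y, m, a, b & s] by rewrite -(eqv_uniq e1).
have [||||v ev5] := @window5_min [:: x; y; m; a; b] => //.
- by have := take_uniq 5 u1; rewrite /= take0.
- by rewrite /= my (ltnW mx') (ltnW ma) (ltnW (ltn_trans ma ab)).
- by rewrite /= /rot3 ma ab.
case/andP=> mv bv; exists (v ++ s); first exact: eqv_trans e1 (eqv_catr s ev5).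
case: v ev5 mv bv => // m' v ev5 mv bv; rewrite /= has_rot_catr //=.
suff -> : all (leq m') (v ++ s) by [].
rewrite all_cat (mv : all (leq m') v) /=; apply/allP=> z zs.
have /allP ms : all (leq m) [:: a, b & s].
  have := mt; have ps := eqv_perm es; rewrite perm_cons in ps.
  by rewrite (perm_all _ ps).
apply: leq_trans (ms z _); last by rewrite !inE zs !orbT.
have : m \in m' :: v by rewrite -(eqv_mem ev5) !inE eqxx !orbT.
by rewrite inE => /orP[/eqP->//|]; apply: (allP mv).
Qed.

(** * Alignment of the smallest letters *)

(** A replacement as a change of three consecutive letters between a prefix [p]
    and a suffix [s]. *)
Lemma moveP w1 w2 : move w1 w2 -> exists p a b c s,
     [/\ a < b, b < c, w1 = p ++ [:: a, b, c & s] & w2 = p ++ [:: b, c, a & s]]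
  \/ [/\ a < b, a < c, w1 = p ++ [:: b, a, c & s] & w2 = p ++ [:: c, a, b & s]].
Proof.
elim=> [a b c w ab bc | a b c w ab ac | x u v _ [p [a [b [c [s [] []]]]]]].
- by exists [::], a, b, c, w; left.
- by exists [::], a, b, c, w; right.
- by move=> ab bc -> ->; exists (x :: p), a, b, c, s; left.
- by move=> ab ac -> ->; exists (x :: p), a, b, c, s; right.
Qed.

(** The letters of [w] at even ([e = false]) or odd ([e = true]) positions,
    counted from 0. *)
Fixpoint par (e : bool) (w : seq nat) : seq nat :=
  if w is x :: w' then if e then par false w' else x :: par true w' else [::].

Lemma par_cat e u v : par e (u ++ v) = par e u ++ par (e (+) odd (size u)) v.
Proof.
elim: u e => [|x u IH] e /=; first by rewrite addbF.
by case: e; rewrite /= IH; case: (odd _).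
Qed.

Lemma perm_par w : perm_eq (par false w ++ par true w) w.
Proof.
suff H : perm_eq (par false w ++ par true w) w /\ perm_eq (par true w ++ par false w) w.
  by case: H.
elim: w => //= x w [IH1 IH2]; split; first by rewrite perm_cons.
by rewrite (perm_catCA _ [:: x]) /= perm_cons.
Qed.

Lemma par_disjoint w e x : uniq w -> x \in par e w -> x \in par (~~ e) w -> False.
Proof.
rewrite -(perm_uniq (perm_par w)) cat_uniq => /and3P[_ /hasPn H _].
by case: e => /= h1 h2; [have := H x h1; rewrite h2 | have := H x h2; rewrite h1].
Qed.

(** When [s] is increasing and [w] has distinct letters: all letters of [s] occur
    in [w] at positions of parity [e], in increasing order. *)
Definition aligned (e : bool) (s w : seq nat) := [seq x <- par e w | x \in s] == s.

Definition down_closed (s w : seq nat) := forall x y, x \in s -> y \in w -> y < x -> y \in s.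

Lemma aligned_mem e s w x : aligned e s w -> x \in s -> x \in par e w.
Proof. by move=> /eqP <-; rewrite mem_filter => /andP[]. Qed.

(** If the window contains letters of [s] other than its least letter [a], then
    [a] belongs to [s] too, and alignment is contradicted: two adjacent letters
    would be in [s], or [s] would not be in increasing order.  So at most [a] is
    in [s]; it moves by two places or not at all. *)
Lemma aligned_step e s w1 w2 : sorted ltn s -> uniq w1 -> down_closed s w1 ->
  move w1 w2 \/ move w2 w1 -> aligned e s w1 -> aligned e s w2.
Proof.
move=> ss uw dc H g.
have notin x : x \in par (~~ e) w1 -> x \notin s.
  by move=> h; apply/negP => /(aligned_mem g) h'; apply: (par_disjoint uw h' h).
have dn x y : y \in w1 -> y < x -> y \notin s -> x \notin s.
  by move=> yw yx; apply: contra => xs; apply: dc yx.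
have [p [a [b [c [r []]]]]] : exists p a b c r,
    (a < b /\ b < c /\ ((w1 = p ++ [:: a, b, c & r] /\ w2 = p ++ [:: b, c, a & r])
     \/ (w1 = p ++ [:: b, c, a & r] /\ w2 = p ++ [:: a, b, c & r]))) \/
    [/\ a < b, a < c, w1 = p ++ [:: b, a, c & r] & w2 = p ++ [:: c, a, b & r]].
  case: H => /moveP[p [a [b [c [r [[h1 h2 h3 h4]|[h1 h2 h3 h4]]]]]]].
  - by exists p, a, b, c, r; left; do !split=> //; left.
  - by exists p, a, b, c, r; right.
  - by exists p, a, b, c, r; left; do !split=> //; right.
  - by exists p, a, c, b, r; right.
- case=> ab [bc [[e1 e2]|[e1 e2]]].
  + have aw : a \in w1 by rewrite e1 mem_cat !inE eqxx orbT.
    have bw : b \in w1 by rewrite e1 mem_cat !inE eqxx !orbT.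
    have [bs cs] : b \notin s /\ c \notin s.
      suff bs : b \notin s by split=> //; apply: dn bs.
      case E : (e (+) odd (size p)).
        apply: dn ab _ => //; apply: notin; rewrite e1 par_cat addNb E /=.
        by rewrite mem_cat inE eqxx orbT.
      by apply: notin; rewrite e1 par_cat addNb E /= mem_cat inE eqxx orbT.
    move: g; rewrite /aligned e1 e2 !par_cat !filter_cat.
    by case: (e (+) _); rewrite /= (negbTE bs) (negbTE cs).
  + have aw : a \in w1 by rewrite e1 mem_cat !inE eqxx !orbT.
    have bw : b \in w1 by rewrite e1 mem_cat !inE eqxx !orbT.
    have [bs cs] : b \notin s /\ c \notin s.
      suff bs : b \notin s by split=> //; apply: dn bs.
      case E : (e (+) odd (size p)).
        apply: dn ab _ => //; apply: notin; rewrite e1 par_cat addNb E /=.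
        by rewrite mem_cat !inE eqxx !orbT.
      apply/negP => bs.
      have as_ := dc b a bs aw ab.
      move: g ss; rewrite /aligned e1 par_cat filter_cat E /= bs as_ => /eqP <-.
      rewrite sorted_pairwise; last exact: ltn_trans.
      by rewrite pairwise_cat /= => /and3P[_ _ /and3P[/andP[]]]; lia.
    move: g; rewrite /aligned e1 e2 !par_cat !filter_cat.
    by case: (e (+) _); rewrite /= (negbTE bs) (negbTE cs).
- case=> ab ac e1 e2.
  have aw : a \in w1 by rewrite e1 mem_cat !inE eqxx !orbT.
  move: g; rewrite /aligned e1 e2 !par_cat !filter_cat.
  case E : (e (+) _) => //=.
  have as_ : a \notin s.
    by apply: notin; rewrite e1 par_cat addNb E /= mem_cat inE eqxx orbT.
  by rewrite (negbTE (dn _ _ aw ab as_)) (negbTE (dn _ _ aw ac as_)).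
Qed.

Lemma aligned_eqv e s w1 w2 : sorted ltn s -> uniq w1 -> down_closed s w1 ->
  eqv w1 w2 -> aligned e s w1 -> aligned e s w2.
Proof.
move=> ss; suff H u v : move u v \/ move v u ->
    [/\ uniq u, down_closed s u & aligned e s u] -> [/\ uniq v, down_closed s v & aligned e s v].
  by move=> uw dw /(eqv_invariant H) /(_ (And3 uw dw _)) h g; case: (h g).
move=> uv [uu du gu]; have puv : perm_eq u v.
  by case: uv => /move_perm //; rewrite perm_sym.
split; last exact: aligned_step uv gu.
- by rewrite -(perm_uniq puv).
- by move=> x y; rewrite -(perm_mem puv); apply: du.
Qed.

(** * Canonical words with a rotatable window *)

(** All letters but the last. *)
Definition init (s : seq nat) := take (size s).-1 s.

Lemma init_rcons s x : init (rcons s x) = s.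
Proof. by rewrite /init size_rcons -cats1 take_size_cat. Qed.

(** For [s] increasing: the least, the greatest, the second least, the second
    greatest letter, and so on, [k] pairs in all, then the remaining letters in
    increasing order. *)
Fixpoint zig (k : nat) (s : seq nat) : seq nat :=
  if k is k'.+1 then
    if s is a :: s' then [:: a, last 0 s' & zig k' (init s')] else [::]
  else s.

(** The canonical word on the increasing sequence [s]; [e] is the parity of the
    position of the least letter, and exactly the [k.+1] smallest letters are
    aligned when at least three letters remain unpaired. *)
Definition canon (e : bool) (k : nat) (s : seq nat) : seq nat :=
  if e then last 0 s :: zig k (init s) else zig k s.

Lemma zigS k a s z : zig k.+1 (a :: rcons s z) = [:: a, z & zig k s].
Proof. by rewrite /= init_rcons last_rcons. Qed.

Lemma canon_true k s z : canon true k (rcons s z) = z :: zig k s.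
Proof. by rewrite /= init_rcons last_rcons. Qed.

Lemma zig_head k a s : exists r, zig k (a :: s) = a :: r.
Proof. by case: k => [|k] /=; eexists. Qed.

Lemma perm_zig k s : k.*2 < size s -> perm_eq (zig k s) s.
Proof.
elim: k s => // k IH [|a s] //; case: (lastP s) => // {}s z.
rewrite zigS /= size_rcons => h; rewrite perm_cons -(perm_rcons z) perm_sym.
rewrite -!cats1 perm_cat2r perm_sym IH //; by lia.
Qed.

Lemma has_rot_zig k s : k.*2 + 2 < size s -> sorted ltn s -> has_rot (zig k s).
Proof.
elim: k s => [|k IH] s.
  by case: s => [|a [|b [|c s]]] // _ /= /and3P[ab bc _]; rewrite /rot3 ab bc.
case: s => // a s; case: (lastP s) => // {}s z; rewrite zigS /= size_rcons => h st.
apply/(has_rot_catl [:: a; z])/IH; first by lia.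
by move: st => /path_sorted; rewrite -cats1; case/cat_sorted2.
Qed.

Lemma sort_min m t : all (leq m) t -> sort leq (m :: t) = m :: sort leq t.
Proof.
move=> mt; apply: (sorted_eq leq_trans anti_leq); rewrite ?sort_sorted //; try exact: leq_total.
- by rewrite /= path_min_sorted ?sort_sorted ?all_sort //; exact: leq_total.
- by rewrite (perm_trans (permEl (perm_sort _ _))) // perm_cons perm_sym perm_sort.
Qed.

Lemma sort_max m t : all (geq m) t -> sort leq (m :: t) = rcons (sort leq t) m.
Proof.
move=> mt; apply: (sorted_eq leq_trans anti_leq); rewrite ?sort_sorted //; try exact: leq_total.
- rewrite sorted_pairwise; last exact: leq_trans.
  rewrite pairwise_rcons all_sort -sorted_pairwise; last exact: leq_trans.
  by rewrite sort_sorted ?andbT //; exact: leq_total.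
- by rewrite (perm_trans (permEl (perm_sort _ _))) // perm_sym perm_rcons perm_cons perm_sort.
Qed.

Lemma sort_perm w1 w2 : perm_eq w1 w2 -> sort leq w1 = sort leq w2.
Proof. by move/(perm_sortP leq_total leq_trans anti_leq). Qed.

Lemma sort_ltn w : uniq w -> sorted ltn (sort leq w).
Proof. by move=> uw; rewrite ltn_sorted_uniq_leq sort_uniq uw sort_sorted //; apply: leq_total. Qed.

Lemma sort_id s : sorted ltn s -> sort leq s = s.
Proof.
move=> ss; apply: sorted_sort; first exact: leq_trans.
by apply: sub_sorted ss => x y /ltnW.
Qed.

Lemma down_closed1 m t : all (leq m) t -> down_closed [:: m] (m :: t).
Proof.
move=> /allP mt x y; rewrite !inE => /eqP -> /orP[// | /mt]; by lia.
Qed.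

Lemma aligned1 m t : uniq (m :: t) -> aligned false [:: m] (m :: t).
Proof.
rewrite /aligned /= inE eqxx => /andP[mt _]; rewrite (eq_in_filter (a2 := pred0)) ?filter_pred0 //.
move=> x xt; rewrite inE /=; apply: contraNF mt => /eqP <-.
by rewrite -(perm_mem (perm_par t)) mem_cat xt orbT.
Qed.

(** The position of the least letter tells the kind of the canonical word. *)
Lemma canon_parity m t e k : uniq (m :: t) -> all (leq m) t -> 2 < size (m :: t) ->
  eqv (m :: t) (canon e k (sort leq (m :: t))) -> e = false.
Proof.
move=> ut mt st h; case: e h => // h.
have := aligned_eqv _ ut (down_closed1 mt) h (aligned1 ut) => /(_ isT).
have uc := ut; rewrite (eqv_uniq h) in uc.
move=> /(aligned_mem (x := m)); rewrite inE eqxx => /(_ isT) mpar.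
suff : m \in par true (canon true k (sort leq (m :: t))) by move/(par_disjoint uc mpar).
rewrite sort_min //; have : size (sort leq t) = size t by rewrite size_sort.
case: (lastP (sort leq t)) => [|s z] ss; first by move: st ss => /=; lia.
rewrite -rcons_cons canon_true; have [r ->] := zig_head k m s.
by rewrite /= inE eqxx.
Qed.

(** [w] is equivalent to a canonical word in which at least three letters are
    left unpaired. *)
Definition canonicalizable w := exists (e : bool) k,
  k.*2 + 3 + e <= size w /\ eqv w (canon e k (sort leq w)).

Lemma canonicalizable_eqv w v : eqv w v -> canonicalizable v -> canonicalizable w.
Proof.
move=> wv [e [k [sk vk]]]; exists e, k; rewrite (eqv_size wv) (sort_perm (eqv_perm wv)).
by split=> //; apply: eqv_trans vk.
Qed.

(** The induction hypothesis on the length used below. *)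
Definition canonicalizable_at n := forall w,
  size w = n -> uniq w -> has_rot w -> canonicalizable w.

(** The canonical word of [a b t] is the increasing one: in every other, [a] and
    [b] are aligned or [a] is not at an even position. *)
Lemma canon_two_least n a b t : canonicalizable_at n ->
    size [:: a, b & t] = n -> uniq [:: a, b & t] ->
  0 < size t -> a < b -> all (ltn b) t -> eqv [:: a, b & t] (sort leq [:: a, b & t]).
Proof.
move=> IH sw uw st ab bt.
have bt' : all (leq b) t by apply: sub_all bt => x /ltnW.
have ale : all (leq a) (b :: t).
  by rewrite /= (ltnW ab); apply: sub_all bt' => x; apply: leq_trans (ltnW ab).
have bw : has_rot [:: a, b & t].
  by case: t st bt {sw uw bt' ale} => //= c t _ /andP[bc _]; rewrite /rot3 ab bc.
have [e [k [sk wk]]] := IH _ sw uw bw.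
have e0 := canon_parity uw ale (has_rot_size bw) wk; subst e.
case: k => [//|k] in sk wk *; exfalso; rewrite /canon in wk.
have uc := uw; rewrite (eqv_uniq wk) in uc.
have es : sort leq [:: a, b & t] = [:: a, b & sort leq t] by rewrite !sort_min.
have st' : size (sort leq t) = size t by rewrite size_sort.
rewrite es in wk uc; case: (lastP (sort leq t)) wk uc st' => [|s z] wk uc st'.
  by move: st' st => /=; lia.
rewrite -rcons_cons zigS in wk uc; have [r er] := zig_head k b s; rewrite er in wk uc.
have dc : down_closed [:: a; b] [:: a, z, b & r].
  move=> x y xab; rewrite -(eqv_mem wk) !inE => /or3P[->//|->|yt yx]; first by rewrite orbT.
  have by_ : b < y := allP bt y yt.
  by move: xab yx; rewrite !inE => /orP[]/eqP ->; lia.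
have sab : sorted ltn [:: a; b] by rewrite /= ab.
have g : aligned false [:: a; b] [:: a, z, b & r].
  rewrite /aligned /= !inE !eqxx orbT (eq_in_filter (a2 := pred0)) ?filter_pred0 //.
  move=> x xr; have xr' : x \in r by rewrite -(perm_mem (perm_par r)) mem_cat xr orbT.
  rewrite !inE; apply/negbTE; apply: contraL uc => /orP[]/eqP <-;
    by rewrite /= !inE xr' ?orbT ?andbF.
have bpar := aligned_mem (aligned_eqv sab uc dc (eqv_sym wk) g) (mem_last a [:: b]).
by apply: (par_disjoint uw bpar); rewrite /= inE eqxx.
Qed.

Lemma canon_max_first n z m t : canonicalizable_at n ->
    size (m :: t) = n -> uniq [:: z, m & t] ->
  all (geq z) (m :: t) -> all (leq m) t -> has_rot (m :: t) ->
  canonicalizable [:: z, m & t].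
Proof.
move=> IH sw uw zw mt bw; have umt : uniq (m :: t) by case/andP: uw.
have [e [k [sk wk]]] := IH _ sw umt bw.
have e0 := canon_parity umt mt (has_rot_size bw) wk; subst e.
exists true, k; rewrite sort_max // canon_true; split; last exact: eqv_cons.
by move: sk => /=; lia.
Qed.

Lemma canon_min_first n m t : canonicalizable_at n ->
    size t = n -> uniq (m :: t) -> all (leq m) t ->
  has_rot t -> canonicalizable (m :: t).
Proof.
move=> IH st umt mt bt; have ut : uniq t by case/andP: umt.
have [e [k [sk tk]]] := IH _ st ut bt.
have ss : size (sort leq t) = size t by rewrite size_sort.
have S := sort_ltn ut.
have ps : perm_eq (sort leq t) t by rewrite perm_sort.
case: e sk tk => sk tk.
  (* The tail starts with its greatest letter, so prepending [m] extends the
     zigzag by one pair. *)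
  exists false, k.+1; rewrite sort_min //; split; first by move: sk => /=; lia.
  case: (lastP (sort leq t)) ss S tk {ps} => [|s z] ss S tk; first by move: sk ss => /=; lia.
  rewrite /canon zigS; rewrite canon_true in tk; exact: eqv_cons.
(* Otherwise the second least letter is not aligned with [m], and the word
   must be shown equivalent to the increasing one. *)
suff : eqv (m :: t) (m :: sort leq t).
  exists false, 0; rewrite sort_min //; split=> //=.
  by have := has_rot_size bt; lia.
case: k sk tk => [|k] sk tk; first exact: eqv_cons.
move: tk; rewrite /canon; case E : (sort leq t) ss S ps => [|b s'] ss S ps.
  by move: sk ss => /=; lia.
case: (lastP s') E ss S ps => {s'} [|s z] E ss S ps; first by move: sk ss => /=; lia.
rewrite zigS; case: s E ss S ps => [|c s] E ss S ps; first by move: sk ss => /=; lia.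
have [r er] := zig_head k c s; rewrite er => tk.
have mem1 x : x \in [:: b, z, c & r] -> x \in [:: b, c & rcons s z].
  by rewrite -(eqv_mem tk) -(perm_mem ps).
have u1 : uniq [:: b, z, c & r] by rewrite -(eqv_uniq tk).
have mlt x : x \in [:: b, z, c & r] -> m < x.
  move=> xt; rewrite -(eqv_mem tk) in xt; rewrite ltn_neqAle (allP mt) // andbT.
  by case/andP: umt => mt' _; apply: contraNneq mt' => ->.
have [bc cr] : b < c /\ all (ltn c) (rcons s z).
  move: S => /= /andP[bc cs]; split=> //; exact: (order_path_min ltn_trans).
have cgt x : x \in [:: z & r] -> c < x.
  move=> xr; have /mem1 : x \in [:: b, z, c & r].
    by move: xr; rewrite !inE => /orP[]->; rewrite !orbT.
  have [nb nc] : x != b /\ x != c.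
    move: u1 => /=; rewrite !inE !negb_or => /and4P[/and3P[bz _ br] /andP[zc zr] cr' _].
    move: xr; rewrite inE => /orP[/eqP->|xr]; first by rewrite eq_sym bz zc.
    by split; [apply: contraNneq br | apply: contraNneq cr'] => <-.
  by rewrite !inE (negbTE nb) (negbTE nc) => /(allP cr).
have mb : m < b by apply: mlt; rewrite inE eqxx.
have mc : m < c by apply: mlt; rewrite !inE eqxx !orbT.
have cz : c < z by apply: cgt; rewrite inE eqxx.
have mz : m < z by apply: ltn_trans cz.
have bz : b < z by apply: ltn_trans cz.
(* In [m b z c r] the letters [z] and [c] can be exchanged by moving [m] past
   [b z] and back; then [b] and [c] are no longer aligned. *)
have h1 : eqv (m :: t) [:: m, b, c, z & r].
  apply: eqv_trans (eqv_cons m tk) _.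
  apply: eqv_trans (eqv_rot _ mb bz) _.
  apply: eqv_trans (eqv_cons b (eqv_swap _ mz mc)) _.
  exact/eqv_sym/eqv_rot.
have p1 : perm_eq t [:: b, c, z & r].
  by have := eqv_perm h1; rewrite perm_cons.
apply: eqv_trans h1 (eqv_cons m _).
rewrite -E (sort_perm p1); apply: (canon_two_least IH) => //.
- by rewrite -(perm_size p1).
- by rewrite -(perm_uniq p1).
- by apply/allP => x /cgt.
Qed.

(** It suffices to replace the first letter [x] by the greatest letter [z]. *)
Lemma canon_min_second n x m t : canonicalizable_at n ->
    size (m :: t) = n -> uniq [:: x, m & t] ->
  m < x -> all (leq m) t -> has_rot (m :: t) -> canonicalizable [:: x, m & t].
Proof.
move=> IH sw uw mx mt bw; have umt : uniq (m :: t) by case/andP: uw.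
have [e [k [sk wk]]] := IH _ sw umt bw.
have e0 := canon_parity umt mt (has_rot_size bw) wk; subst e; rewrite /canon in wk.
have [xmax|xmax] := boolP (all (geq x) (m :: t)); first exact: (canon_max_first IH).
have ss : size (sort leq (m :: t)) = (size t).+1 by rewrite size_sort.
have st : size t = n.-1 by rewrite -sw.
have ps : perm_eq (sort leq (m :: t)) (m :: t) by rewrite perm_sort.
have S := sort_ltn umt.
rewrite sort_min // in wk ss ps S.
case: (lastP (sort leq t)) wk ss ps S => [|s z] wk ss ps S.
  by have := has_rot_size bw; move: ss => /=; lia.
have zmax y : y \in m :: t -> y <= z.
  rewrite -(perm_mem ps) -rcons_cons mem_rcons inE => /orP[/eqP->//|].
  move: S; rewrite -rcons_cons sorted_pairwise; last exact: ltn_trans.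
  by rewrite pairwise_rcons => /andP[/allP h _] /h /= /ltnW.
have xz : x < z.
  have : ~~ all (geq x) (m :: t) by [].
  rewrite -has_predC => /hasP[y /zmax yz] /=; rewrite -ltnNge => xy; exact: leq_trans yz.
have mz : m < z by apply: ltn_trans xz.
have ew : eqv [:: x, m & t] (x :: zig k (m :: rcons s z)) by apply: eqv_cons.
have finish r : perm_eq [:: x, m & t] [:: z, m & r] -> has_rot (m :: r) ->
    canonicalizable [:: z, m & r].
  move=> pr br; have ur : uniq [:: z, m & r] by rewrite -(perm_uniq pr).
  have sr : size (m :: r) = n by rewrite -sw; have := perm_size pr => /= -[->].
  have memr y : y \in r -> y = x \/ y \in t.
    move=> yr; have : y \in [:: x, m & t] by rewrite (perm_mem pr) !inE yr !orbT.
    rewrite !inE => /or3P[/eqP->|/eqP ym|->]; [by left| |by right].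
    by move: ur; rewrite -ym /= yr andbF.
  apply: (canon_max_first IH) => //=.
    rewrite (ltnW mz); apply/allP => y /memr[->|yt]; first exact: ltnW.
    by apply: zmax; rewrite inE yt orbT.
  by apply/allP => y /memr[->|/(allP mt)//]; apply: ltnW.
(* If [k > 0], the canonical form of the tail starts with [m z], and [x] and
   [z] are exchanged at once. *)
case: k sk wk ew => [|k] sk wk ew; last first.
  rewrite zigS in ew.
  have e1 := eqv_trans ew (eqv_swap _ mx mz).
  apply: (canonicalizable_eqv e1); apply: finish (eqv_perm e1) _.
  apply/(has_rot_catl [:: m; x])/has_rot_zig.
    by move: sk ss => /=; rewrite size_rcons; lia.
  by move: S => /path_sorted; rewrite -cats1; case/cat_sorted2.
(* Otherwise the letters after [x] can be put in increasing order.  If the letter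
   [b] after [m] is below the first letter [y], bring [z] next to [b], move [m]
   out of the way, exchange [y] and [z], and move [m] back. *)
have key y b r : eqv [:: x, m & t] [:: y, m, b & r] -> m < b -> b < y -> all (ltn b) r ->
    z \in r -> y < z -> canonicalizable [:: x, m & t].
  move=> e1 mb by_ br zr yz; have p1 := eqv_perm e1.
  have u1 : uniq [:: y, m, b & r] by rewrite -(perm_uniq p1).
  have pz := perm_to_rem zr; set r' := rem z r in pz.
  have bz : b < z by apply: ltn_trans yz.
  have e2 : eqv [:: m, b & r] [:: m, b, z & r'].
    have sp : perm_eq [:: m, b & r] [:: m, b, z & r'] by rewrite !perm_cons.
    have sb : size [:: m, b & r] = n by rewrite -sw; have := perm_size p1 => /= -[->].
    have ub : uniq [:: m, b & r] by case/andP: u1.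
    apply: (@eqv_trans (sort leq [:: m, b & r])).
      by apply: (canon_two_least IH) => //; case: (r) zr.
    rewrite (sort_perm sp); apply/eqv_sym/(canon_two_least IH) => //.
    - by rewrite -(perm_size sp).
    - by rewrite -(perm_uniq sp).
    - by rewrite -(perm_all _ pz).
  have my : m < y by apply: ltn_trans by_.
  have e3 : eqv [:: x, m & t] [:: z, m, b, y & r'].
    apply: eqv_trans e1 _; apply: eqv_trans (eqv_cons y e2) _.
    apply: eqv_trans (eqv_cons y (eqv_rot _ mb bz)) _.
    apply: eqv_trans (eqv_swap _ by_ bz) _.
    by apply/eqv_cons/eqv_sym/eqv_rot.
  apply: (canonicalizable_eqv e3); apply: finish (eqv_perm e3) _.
  by rewrite /= /rot3 mb by_.
move: ew S ss; rewrite /zig; case: s {wk ps} => [|b s] ew S ss.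
  by have := has_rot_size bw; move: ss => /=; lia.
have mb : m < b by case/andP: S.
have bs : all (ltn b) (rcons s z).
  by move: S => /= /andP[_]; apply: (order_path_min ltn_trans).
have xb : x != b.
  have := eqv_uniq ew; rewrite uw /= !inE !negb_or => /esym /andP[/and3P[]] //.
have [bx|xb'] := ltnP b x.
  by apply: key ew mb bx bs _ xz; rewrite mem_rcons inE eqxx.
(* Here [x] is the second least letter: exchange it with [b] first. *)
have {xb'} xb' : x < b by rewrite ltn_neqAle xb.
apply: (key b x (rcons s z)) => //.
- exact: eqv_trans ew (eqv_swap _ mx mb).
- by apply: sub_all bs => y; apply: ltn_trans.
- by rewrite mem_rcons inE eqxx.
- by apply: (allP bs); rewrite mem_rcons inE eqxx.
Qed.

Theorem rot_canonical w : uniq w -> has_rot w -> canonicalizable w.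
Proof.
elim: {w}(size w) {-2}w (erefl (size w)) => [|n IH] w sw uw bw.
  by have := has_rot_size bw; rewrite sw.
have [n3|n3] := leqP (size w) 3.
  have sw3 : size w = 3 by apply/eqP; rewrite eqn_leq n3 has_rot_size.
  exists false, 0; rewrite sw3; split=> //.
  case: w {IH sw n3} sw3 uw bw => [|a [|b [|c []]]] //= _ _.
  rewrite !orbF /rot3 => /orP[/andP[ab bc]|/andP[ca ab]].
    by rewrite (sort_id (s := [:: a; b; c])) /= ?ab ?bc //; apply: EqvRefl.
  rewrite (sort_perm (_ : perm_eq _ [:: c; a; b])); last first.
    by apply/seq.permP => P /=; lia.
  by rewrite (sort_id (s := [:: c; a; b])) /= ?ab ?ca //; apply/eqv_sym/eqv_rot.
have [v wv] := rot_normalize uw n3 bw.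
have uv : uniq v by rewrite -(eqv_uniq wv).
have sv : size v = n.+1 by rewrite -(eqv_size wv).
case/andP=> bv mv; apply: (canonicalizable_eqv wv) => {wv}; case/orP: mv => mv.
  case: v uv sv bv mv => // m t ut [st] bt mt; exact: (canon_min_first IH).
case: v uv sv bv mv => [|x [|m t]] // ut [st] bt /= /andP[mx mt].
apply: (canon_min_second IH) => //; rewrite ltn_neqAle mx andbT.
by move: ut => /=; rewrite inE negb_or eq_sym => /andP[/andP[]].
Qed.

(** * Inequivalence of the canonical words *)

Lemma zig_iota k a m : zig k.+1 (iota a m.+2) = [:: a, a + m.+1 & zig k (iota a.+1 m)].
Proof. by rewrite [iota a m.+2]/= -/(iota a.+1 m.+1) iota_rcons zigS addSnnS. Qed.

Lemma par_zig k a l : par false (zig k (iota a (l + k.*2))) =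
  iota a k ++ par false (iota (a + k) l).
Proof.
elim: k a => [|k IH] a; first by rewrite double0 !addn0.
by rewrite doubleS !addnS zig_iota /= IH addSn.
Qed.

Lemma canon_iota e k n : canon e k (iota 1 (n + e)) =
  if e then n.+1 :: zig k (iota 1 n) else zig k (iota 1 n).
Proof. by case: e; rewrite ?addn0 // addn1 iota_rcons canon_true add1n. Qed.

Lemma par_canon e k l : par e (canon e k (iota 1 (l + k.*2 + e))) =
  iota 1 k ++ par false (iota k.+1 l).
Proof. by rewrite canon_iota -add1n; case: e; rewrite /= par_zig. Qed.

Lemma perm_canon e k l : 0 < l ->
  perm_eq (canon e k (iota 1 (l + k.*2 + e))) (iota 1 (l + k.*2 + e)).
Proof.
move=> l0; rewrite canon_iota.
have p : perm_eq (zig k (iota 1 (l + k.*2))) (iota 1 (l + k.*2)).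
  by apply: perm_zig; rewrite size_iota; lia.
case: e; last by rewrite addn0.
by rewrite addn1 iota_rcons perm_sym perm_rcons add1n perm_cons perm_sym.
Qed.

Lemma par_sub e w x : x \in par e w -> x \in w.
Proof.
by rewrite -(perm_mem (perm_par w)) mem_cat; case: e => ->; rewrite ?orbT.
Qed.

Lemma aligned_canon e k l j : 2 < l -> j <= k.+1 ->
  aligned e (iota 1 j) (canon e k (iota 1 (l + k.*2 + e))).
Proof.
move=> l2 jk; rewrite /aligned par_canon.
have -> : par false (iota k.+1 l) = k.+1 :: par false (iota k.+3 (l - 2)).
  by case: l l2 => [|[|[|l]]].
rewrite -cat_rcons -[k.+1]add1n -iota_rcons filter_cat.
rewrite [X in _ ++ X](eq_in_filter (a2 := pred0)) ?filter_pred0 ?cats0; last first.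
  by move=> x /par_sub; rewrite !mem_iota /=; lia.
apply/eqP/(irr_sorted_eq ltn_trans ltnn).
- by apply: sorted_filter; [exact: ltn_trans | exact: iota_ltn_sorted].
- exact: iota_ltn_sorted.
by move=> x; rewrite mem_filter !mem_iota; lia.
Qed.

Lemma not_aligned_canon e k l : 2 < l ->
  ~~ aligned e (iota 1 k.+2) (canon e k (iota 1 (l + k.*2 + e))).
Proof.
move=> l2; apply/negP => /(aligned_mem (x := k.+2)).
rewrite mem_iota !add1n !ltnS !leqnn => /(_ isT).
have -> : (k.+2 \in par e (canon e k (iota 1 (l + k.*2 + e)))) = (k.+2 \in par false (iota k.+1 l)).
  by rewrite par_canon mem_cat mem_iota; have -> : (0 < k.+2 < 1 + k) = false by lia.
case: l l2 => [|[|[|l]]] // _; rewrite /= !in_cons.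
by case/or3P => [/eqP|/eqP|/par_sub]; rewrite ?mem_iota; lia.
Qed.

(** The word with more aligned letters cannot be equivalent to the other. *)
Lemma canon_le (e : bool) k1 l1 k2 l2 : 2 < l1 -> 2 < l2 ->
    l1 + k1.*2 + e = l2 + k2.*2 + e ->
    eqv (canon e k1 (iota 1 (l1 + k1.*2 + e))) (canon e k2 (iota 1 (l1 + k1.*2 + e))) ->
  k2 <= k1.
Proof.
move=> h1 h2 en h; rewrite leqNgt; apply/negP => k12.
have /negP := @not_aligned_canon e k1 l1 h1; apply.
have l1p : 0 < l1 by lia.
have p1 := perm_canon e k1 l1p.
apply: aligned_eqv (eqv_sym h) _.
- exact: iota_ltn_sorted.
- by rewrite -(eqv_uniq h) (perm_uniq p1) iota_uniq.
- by move=> x y; rewrite -(eqv_mem h) (perm_mem p1) !mem_iota; lia.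
- by rewrite en; apply: aligned_canon; lia.
Qed.

Lemma canon_inj n (e1 : bool) k1 (e2 : bool) k2 : k1.*2 + 3 + e1 <= n -> k2.*2 + 3 + e2 <= n ->
  eqv (canon e1 k1 (iota 1 n)) (canon e2 k2 (iota 1 n)) -> e1 = e2 /\ k1 = k2.
Proof.
move=> h1 h2 h.
have [l1 [l1_2 en1]] : exists l, 2 < l /\ n = l + k1.*2 + e1.
  by exists (n - k1.*2 - e1); split; lia.
have [l2 [l2_2 en2]] : exists l, 2 < l /\ n = l + k2.*2 + e2.
  by exists (n - k2.*2 - e2); split; lia.
have l1p : 0 < l1 by lia.
have := perm_canon e1 k1 l1p; rewrite -en1 => p1.
have ee : e1 = e2.
  have g1 : aligned e1 (iota 1 1) (canon e1 k1 (iota 1 n)) by rewrite en1; apply: aligned_canon.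
  have g2 : aligned e2 (iota 1 1) (canon e2 k2 (iota 1 n)) by rewrite en2; apply: aligned_canon.
  have u1 : uniq (canon e1 k1 (iota 1 n)) by rewrite (perm_uniq p1) iota_uniq.
  have u2 : uniq (canon e2 k2 (iota 1 n)) by rewrite -(eqv_uniq h).
  have g3 : aligned e1 (iota 1 1) (canon e2 k2 (iota 1 n)).
    apply: aligned_eqv h g1 => //.
    by move=> x y; rewrite (perm_mem p1) !mem_iota; lia.
  have m : 1 \in iota 1 1 by [].
  have := par_disjoint u2 (aligned_mem g2 m); have := aligned_mem g3 m.
  by case: (e1) (e2) => [] [] // ? /(_ _); case.
subst e2; split=> //; apply/eqP; rewrite eqn_leq; apply/andP; split.
  apply: (@canon_le e1 k2 l2 k1 l1) => //; rewrite -en2 //; exact: eqv_sym.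
by apply: (@canon_le e1 k1 l1 k2 l2) => //; rewrite -en1.
Qed.

(** The canonical words on [1, ..., n] with at least three unpaired letters. *)
Definition rot_reps n : seq (seq nat) :=
  [seq canon false k (iota 1 n) | k <- iota 0 n.-1./2] ++
  [seq canon true k (iota 1 n) | k <- iota 0 n.-2./2].

Lemma size_rot_reps n : 1 < n -> size (rot_reps n) = n - 2.
Proof. by rewrite size_cat !size_map !size_iota; lia. Qed.

Lemma mem_rot_reps n w : reflect
  (exists (e : bool) k, k.*2 + 3 + e <= n /\ w = canon e k (iota 1 n))
  (w \in rot_reps n).
Proof.
rewrite mem_cat; apply: (iffP orP) => [[]/mapP[k + ->]|[[] [k [hk ->]]]].
- by rewrite mem_iota => hk; exists false, k; split=> //; lia.
- by rewrite mem_iota => hk; exists true, k; split=> //; lia.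
- by right; apply: map_f; rewrite mem_iota; lia.
- by left; apply: map_f; rewrite mem_iota; lia.
Qed.

Lemma rot_reps_has_rot n w : w \in rot_reps n -> has_rot w.
Proof.
move=> /mem_rot_reps[e [k [hk ->]]].
have -> : n = (n - e) + e by lia.
rewrite canon_iota; have z : has_rot (zig k (iota 1 (n - e))).
  by apply: has_rot_zig; [rewrite size_iota; lia | exact: iota_ltn_sorted].
by case: ifP => // _; apply: has_rot_consr.
Qed.

Lemma rot_reps_perm n w : w \in rot_reps n -> perm_eq w (iota 1 n).
Proof.
move=> /mem_rot_reps[e [k [hk ->]]].
have -> : n = (n - e - k.*2) + k.*2 + e by lia.
by apply: perm_canon; lia.
Qed.

Lemma rot_reps_inj n : {in rot_reps n &, forall u v, eqv u v -> u = v}.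
Proof.
move=> _ _ /mem_rot_reps[e [k [hk ->]]] /mem_rot_reps[e' [k' [hk' ->]]].
by move=> /canon_inj => /(_ hk hk') [-> ->].
Qed.

Lemma rot_reps_uniq n : uniq (rot_reps n).
Proof.
have inj (e : bool) : {in [pred k | k.*2 + 3 + e <= n] &,
    injective (fun k => canon e k (iota 1 n))}.
  move=> k1 k2; rewrite !inE => h1 h2 ee.
  by have [] := @canon_inj n e k1 e k2 h1 h2; rewrite ?ee //; apply: EqvRefl.
rewrite cat_uniq; apply/and3P; split.
- rewrite map_inj_in_uniq ?iota_uniq // => k1 k2; rewrite !mem_iota => h1 h2.
  by apply: (inj false); rewrite inE; lia.
- apply/hasPn => _ /mapP[k hk ->]; apply/mapP => -[k' hk' ek].
  suff [] : true = false /\ k = k' by [].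
  apply: (@canon_inj n).
  + by move: hk; rewrite mem_iota; lia.
  + by move: hk'; rewrite mem_iota; lia.
  + by rewrite ek; apply: EqvRefl.
- rewrite map_inj_in_uniq ?iota_uniq // => k1 k2; rewrite !mem_iota => h1 h2.
  by apply: (inj true); rewrite inE; lia.
Qed.

Lemma rot_reps_complete n w : perm_eq w (iota 1 n) -> has_rot w ->
  exists2 v, v \in rot_reps n & eqv w v.
Proof.
move=> pw bw; have uw : uniq w by rewrite (perm_uniq pw) iota_uniq.
have [e [k [hk ek]]] := rot_canonical uw bw.
exists (canon e k (iota 1 n)).
  by apply/mem_rot_reps; exists e, k; rewrite -(size_iota 1 n) -(perm_size pw).
by rewrite -(sort_id (iota_ltn_sorted 1 n)) -(sort_perm pw).
Qed.

(** * Blocks of peaks and valleys *)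

Lemma geq_total : total geq. Proof. by move=> x y; apply: leq_total. Qed.
Lemma geq_trans : transitive geq. Proof. by move=> y x z h1 h2; apply: leq_trans h2 h1. Qed.
Lemma geq_anti : antisymmetric geq. Proof. by move=> x y; rewrite /= andbC => /anti_leq. Qed.

(** The peaks and the valleys of a block. *)
Definition block := (seq nat * seq nat)%type.

(** The word starts with an ascent. *)
Definition asc w := if w is [:: x, y & _] then x < y else false.

(** Adds a peak [p] and a valley [v] in front of the first block; peaks are kept
    in decreasing order. *)
Definition push p v (B : seq block) :=
  if B is (P, V) :: r then (sort geq (p :: P), v :: V) :: r else [::].

(** The block decomposition of [w], peaks sorted and valleys in order of
    occurrence.  The first letter is taken as a peak; the second one is a valley
    of the same block exactly when it is followed by an ascent. *)
Fixpoint blocks w : seq block :=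
  if w is p :: w1 then
    if w1 is v :: w2 then
      if asc w1 then push p v (blocks w2) else ([:: p], [::]) :: blocks w1
    else [:: ([:: p], [::])]
  else [::].

Definition letters (B : seq block) := flatten [seq b.1 ++ b.2 | b <- B].

Definition next_peaks (B : seq block) := if B is (P, _) :: _ then P else [::].

(** In each block the valleys are increasing, below the peaks of the block and
    below those of the next block, and the peaks exceed all later letters. *)
Fixpoint valid (B : seq block) : bool :=
  if B is (P, V) :: r then
    [&& sorted gtn P, size P == (size V).+1, sorted ltn V, allrel ltn V P,
        allrel gtn P (letters r), allrel ltn V (next_peaks r) & valid r]
  else true.

Lemma blocks_asc p v w : asc (v :: w) -> blocks [:: p, v & w] = push p v (blocks w).
Proof. by case: w => // q w /= ->. Qed.

Lemma blocks_desc p w : ~~ asc w -> blocks (p :: w) = ([:: p], [::]) :: blocks w.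
Proof. by case: w => [|v [|q w]] //= /negbTE ->. Qed.

(** The first letter only contributes a peak to the first block. *)
Lemma blocks_head w : exists P V r, forall p, blocks (p :: w) = (sort geq (p :: P), V) :: r.
Proof.
elim: {w}(size w).+1 {-2}w (ltnSn (size w)) => // n IH w sw.
have [aw|aw] := boolP (asc w); last first.
  by exists [::], [::], (blocks w) => p; rewrite blocks_desc.
case: w aw sw => [|v [|q w]] // aw sw.
have [|P [V [r e]]] := IH w; first by move: sw => /=; lia.
by exists (sort geq (q :: P)), (v :: V), r => p; rewrite blocks_asc // e.
Qed.

Lemma blocks_cons p w : exists P V r, blocks (p :: w) = (P, V) :: r /\ p \in P.
Proof.
have [P [V [r ->]]] := blocks_head w; exists (sort geq (p :: P)), V, r; split=> //.
by rewrite mem_sort inE eqxx.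
Qed.

Lemma blocks_sorted w P V r : blocks w = (P, V) :: r -> sorted geq P.
Proof.
case: w => // p w; have [P' [V' [r' ->]]] := blocks_head w => -[<- _ _].
exact: (sort_sorted geq_total).
Qed.

Lemma perm_blocks w : perm_eq (letters (blocks w)) w.
Proof.
elim: {w}(size w).+1 {-2}w (ltnSn (size w)) => // n IH [|p w] //= sw.
case: w sw => // v w sw; case: ifP => [aw|_]; last first.
  by rewrite perm_cons; apply: IH; move: sw => /=; lia.
case: w aw sw => // q w _ sw; have [P [V [r [e _]]]] := blocks_cons q w.
have := IH (q :: w); rewrite e /= => /(_ _) h.
have {h} : perm_eq (P ++ V ++ letters r) (q :: w).
  by move: h; rewrite /letters /= catA; apply; move: sw => /=; lia.
move=> h; apply/seq.permP => a; have := seq.permP h a.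
have ps := seq.permP (permEl (perm_sort geq (p :: P))) a.
rewrite /letters /= in ps *; rewrite !count_cat ps /=; lia.
Qed.

Lemma mem_letters P V r x :
  (x \in letters ((P, V) :: r)) = [|| x \in P, x \in V | x \in letters r].
Proof. by rewrite /letters /= !mem_cat orbA. Qed.

Lemma next_letters r x : x \in next_peaks r -> x \in letters r.
Proof. by case: r => // -[P V] r; rewrite mem_letters => /= ->. Qed.

Lemma allrel_sortl (R : rel nat) s t : allrel R (sort geq s) t = allrel R s t.
Proof. by apply: eq_allrel_meml => x; rewrite mem_sort. Qed.

Lemma allrel_sortr (R : rel nat) s t : allrel R t (sort geq s) = allrel R t s.
Proof. by apply: eq_allrel_memr => x; rewrite mem_sort. Qed.

(** The conditions for a peak and a valley to extend a valid list of blocks. *)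
Lemma valid_push p v P V r : sorted geq P -> valid (push p v ((P, V) :: r)) =
  [&& valid ((P, V) :: r), p \notin P, v < p, all (gtn p) V, all (gtn p) (letters r),
      all (ltn v) P, all (ltn v) V & all (ltn v) (next_peaks r)].
Proof.
move=> sP; rewrite /= !gtn_sorted_uniq_geq sort_uniq size_sort.
rewrite (sort_sorted geq_total) sP !andbT cons_uniq !allrel_sortl allrel_sortr /= eqSS.
rewrite (path_sortedE ltn_trans) !allrel_consl allrel_consr /=.
apply/idP/idP => H; repeat (match goal with h : is_true (_ && _) |- _ =>
    let h1 := fresh in let h2 := fresh in case/andP: h => h1 h2 end);
  by repeat (apply/andP; split).
Qed.

Lemma valid_single p r : valid (([:: p], [::]) :: r) = all (gtn p) (letters r) && valid r.
Proof. by rewrite /= allrel1l. Qed.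

Lemma valid_desc w : valid (blocks w) -> ~~ asc w.
Proof.
case: w => [|a [|b w]] //; rewrite /asc -leqNgt; have [aw|aw] := boolP (asc (b :: w)).
  case: w aw => // q w aw; rewrite blocks_asc //.
  have [P [V [r [-> _]]]] := blocks_cons q w.
  case/and5P=> _ _ _ /allrelP/(_ b a) + _; rewrite !inE eqxx mem_sort inE eqxx.
  by move=> /(_ isT isT)/ltnW.
rewrite blocks_desc // valid_single => /andP[+ _].
have [P [V [r [-> bP]]]] := blocks_cons b w.
by move=> /allP/(_ b); rewrite mem_letters bP => /(_ isT)/ltnW.
Qed.

Lemma valid_tail_asc p v w : asc (v :: w) -> valid (blocks [:: p, v & w]) -> valid (blocks w).
Proof.
move=> aw; rewrite blocks_asc //; case: w aw => // q w _.
have [P [V [r [e _]]]] := blocks_cons q w; rewrite e valid_push ?(blocks_sorted e) //.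
by case/andP.
Qed.

Lemma valid_tail_desc p w : ~~ asc w -> valid (blocks (p :: w)) -> valid (blocks w).
Proof. by move=> aw; rewrite blocks_desc // valid_single => /andP[]. Qed.

(** The letter [z] is a valley of the same block as [a] or a peak of the next
    block. *)
Lemma valid_after_asc x a q z w : a < q -> valid (blocks [:: x, a, q, z & w]) -> a < z.
Proof.
move=> aq; rewrite blocks_asc //.
have [P [V [r [e _]]]] := blocks_cons q (z :: w); rewrite e valid_push ?(blocks_sorted e) //.
case/and5P=> _ _ _ _ /and4P[_ _ /allP aV /allP an].
have [aw|aw] := boolP (asc (z :: w)).
  move: e; rewrite blocks_asc //; case: w aw => // y w _.
  have [P' [V' [r' [-> _]]]] := blocks_cons y w => -[_ eV _].
  by apply: aV; rewrite -eV inE eqxx.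
have er : blocks (z :: w) = r by move: e; rewrite blocks_desc // => -[].
by apply: an; rewrite -er; have [P' [V' [r' [-> ]]]] := blocks_cons z w.
Qed.

Lemma valid_no_rot w : valid (blocks w) -> ~~ has_rot w.
Proof.
have H w' : valid (blocks w') -> ~~ rot_head w'.
  case: w' => [|a [|b [|c w']]] // /valid_desc; rewrite /= /rot3; lia.
elim: {w}(size w).+1 {-2}w (ltnSn (size w)) => // n IH [|a w] // sw vw.
rewrite has_rot_cons negb_or H //=; have [aw|aw] := boolP (asc w); last first.
  by apply: IH; [move: sw => /=; lia | apply: valid_tail_desc vw].
case: w aw sw vw => // b w aw sw vw.
have vw' := valid_tail_asc aw vw.
rewrite has_rot_cons negb_or IH ?andbT //; last by move: sw => /=; lia.
case: w aw sw vw vw' => [|q [|z w]] // aw _ vw /valid_desc; rewrite -leqNgt /= => zq.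
have := valid_after_asc aw vw; move: aw => /=; rewrite /rot3; lia.
Qed.

Lemma sym_moveP u v : move u v \/ move v u ->
  [\/ rot_head u,
      exists a b c s, [/\ u = [:: b, a, c & s], v = [:: c, a, b & s], a < b & a < c]
    | exists x u' v', [/\ u = x :: u', v = x :: v' & move u' v' \/ move v' u']].
Proof.
case=> h; case: h => [a b c w ab bc | a b c w ab ac | x u' v' h].
- by apply: Or31; rewrite /= /rot3 ab bc.
- by apply: Or32; exists a, b, c, w.
- by apply: Or33; exists x, u', v'; split=> //; left.
- by apply: Or31; rewrite /= /rot3 ab bc orbT.
- by apply: Or32; exists a, c, b, w.
- by apply: Or33; exists x, v', u'; split=> //; right.
Qed.

(** In a valid word a replacement is a swap of two consecutive peaks of a
    block. *)
Lemma blocks_move u v : move u v \/ move v u -> valid (blocks u) -> blocks v = blocks u.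
Proof.
elim: {u}(size u).+1 {-2}u v (ltnSn (size u)) => // n IH u v su mv vu.
have nb w : valid (blocks w) -> rot_head w -> False.
  by move=> /valid_no_rot /negP h /rot_head_has_rot.
case/sym_moveP: mv => [/(nb _ vu)//|[a [b [c [s [eu -> ab ac]]]]]|[x [u' [v' [eu -> mv]]]]].
  rewrite eu !blocks_asc //; have [P [V [r e]]] := blocks_head s; rewrite !e /=.
  congr ((_, _) :: _); apply/(perm_sortP geq_total geq_trans geq_anti).
  have ps y : perm_eq (sort geq (y :: P)) (y :: P) by rewrite perm_sort.
  by apply/seq.permP => f /=; rewrite !(seq.permP (ps _)) /=; lia.
subst u; have [au|au] := boolP (asc u'); last first.
  have vu' := valid_tail_desc au vu.
  have e := IH u' v' _ mv vu'.
  rewrite !blocks_desc ?e //; try by move: su => /=; lia.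
  by apply: valid_desc; rewrite e //; move: su => /=; lia.
case: u' au mv su vu => // a u' au mv su vu.
have vu' := valid_tail_asc au vu.
case/sym_moveP: mv => [bu|[a' [b [c [s [[eb eu] _ ab ac]]]]]|[y [u'' [v'' [[<- <-] -> mv]]]]].
- exfalso; case: u' au bu vu vu' {su} => [|q [|z w]] // aq bu vu /valid_desc.
  by have := valid_after_asc aq vu; move: bu aq; rewrite /= /rot3; lia.
- by move: au; rewrite eu /= eb; lia.
have su' : size u' < n by move: su => /=; lia.
have e := IH u' v'' su' mv vu'.
rewrite !blocks_asc ?e //; case: u' v'' au vu e {mv su su' vu'} => // q u' [|q' v''] aq vu e.
  by have := perm_size (perm_blocks (q :: u')); rewrite -e.
move: vu; rewrite blocks_asc // -e; have [P [V [r [e' qP]]]] := blocks_cons q' v''.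
rewrite e' valid_push; last exact: blocks_sorted e'.
by case/and5P=> _ _ _ _ /and4P[_ /allP /(_ _ qP)].
Qed.

(** * Classes without rotatable window *)

(** No member of the class of [w] has a rotatable window. *)
Definition rot_free w := forall v, eqv w v -> ~~ has_rot v.

Lemma blocks_eqv u v : eqv u v -> valid (blocks u) -> blocks v = blocks u.
Proof.
move=> uv vu; apply: (eqv_invariant (P := fun w => blocks w = blocks u)) uv _ => // w1 w2 m e.
by rewrite (blocks_move m) e.
Qed.

Lemma valid_rot_free w : valid (blocks w) -> rot_free w.
Proof. by move=> vw v wv; apply: valid_no_rot; rewrite (blocks_eqv wv). Qed.

Lemma rot_free_eqv u v : eqv u v -> rot_free u -> rot_free v.
Proof. by move=> uv su w vw; apply: su; apply: eqv_trans uv vw. Qed.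

Lemma rot_free_tail x w : rot_free (x :: w) -> rot_free w.
Proof. by move=> h v wv; have := h _ (eqv_cons x wv); apply: contra; apply: has_rot_consr. Qed.

Lemma rot_free_rot_head w : rot_free w -> ~~ rot_head w.
Proof. by move/(_ w (EqvRefl w)); apply: contra; apply: rot_head_has_rot. Qed.

(** Every peak [q] of the first block can be brought to the front, leaving the
    second letter in place. *)
Lemma peak_to_front p w P V r q : blocks (p :: w) = (P, V) :: r -> valid (blocks (p :: w)) ->
  q \in P -> q = p \/ exists y s1 s2, w = y :: s1 /\ eqv [:: p, y & s1] [:: q, y & s2].
Proof.
elim: {w}(size w).+1 {-2}w p P V r (ltnSn (size w)) => // n IH w p P V r sw.
have [aw|aw] := boolP (asc w); last first.
  by rewrite blocks_desc // => -[<- _ _] _; rewrite inE => /eqP; left.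
case: w aw sw => [|y [|q0 w]] // aw sw; rewrite blocks_asc //.
have [P' [V' [r' [e qP']]]] := blocks_cons q0 w; rewrite e.
move=> -[<- _ _]; rewrite valid_push ?(blocks_sorted e) // mem_sort inE.
case/and5P=> vw _ yp _ /and4P[_ /allP yP _ _] /orP[/eqP|qP]; first by left.
have yq := yP _ qP; right; exists y, (q0 :: w).
rewrite -e in vw; case: (IH _ _ _ _ _ _ e vw qP) => [|->|[z [s1 [s2 [-> h]]]]].
- by move: sw => /=; lia.
- by exists (p :: w); split=> //; apply: eqv_swap.
exists [:: p, z & s2]; split=> //.
by apply: eqv_trans (eqv_cons p (eqv_cons y h)) _; apply: eqv_swap.
Qed.

(** If a word without rotations starts with an ascent [x y], then [x] is a valley
    below all letters that may take the place of its successor, namely the peaks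
    of its block, and below the peaks of the next block, each of which can be
    brought next to [y] when [y] is a block of its own. *)
Lemma first_valley_lt x y w P V r : rot_free [:: x, y & w] -> uniq [:: x, y & w] -> x < y ->
    valid (blocks (y :: w)) -> blocks (y :: w) = (P, V) :: r ->
  [/\ all (ltn x) P, all (ltn x) V & all (ltn x) (next_peaks r)].
Proof.
move=> sw uw xy vw e; case: w sw uw vw e => [|z w] sw uw vw e.
  by case: e => <- <- <-; rewrite /= xy.
have zy : z <= y by have := valid_desc vw; rewrite /= -leqNgt.
have xz : x < z.
  have := rot_free_rot_head sw; rewrite /= /rot3.
  by move: uw; rewrite /= !inE; lia.
have [aw|aw] := boolP (asc (z :: w)).
  move: e vw; rewrite blocks_asc //; case: w aw {sw uw} => // q w aw.
  have [P' [V' [r' [e qP]]]] := blocks_cons q w; rewrite e => -[<- <- <-].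
  rewrite valid_push ?(blocks_sorted e) // => /and5P[_ _ _ _ /and4P[_ zP zV zn]].
  have lt s : all (ltn z) s -> all (ltn x) s by apply: sub_all => t; apply: ltn_trans.
  by rewrite all_sort /= xy xz !lt.
have vw' := valid_tail_desc aw vw.
have [eP eV er] : [/\ [:: y] = P, [::] = V & blocks (z :: w) = r].
  by move: e; rewrite blocks_desc // => -[].
rewrite -eP -eV -er [all _ [:: y]]/= xy {e}; split=> //.
have [P' [V' [r' [e zP]]]] := blocks_cons z w; rewrite e /=.
apply/allP => q qP; case: (peak_to_front e vw' qP) => [->//|[t [s1 [s2 [ew h]]]]].
rewrite ew in sw uw.
have h' := eqv_cons x (eqv_cons y h).
have := rot_free_rot_head (rot_free_eqv h' sw); rewrite (eqv_uniq h') in uw.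
by move: uw; rewrite /= /rot3 !inE; lia.
Qed.

Lemma rot_free_valid p w : rot_free (p :: w) -> uniq (p :: w) -> ~~ asc (p :: w) ->
  valid (blocks (p :: w)).
Proof.
elim: {w}(size w).+1 {-2}w p (ltnSn (size w)) => // n IH [|x w] p sw smw uw; first by [].
rewrite /asc -leqNgt => xp.
have {}xp : x < p by move: uw xp; rewrite /= inE; lia.
have smx := rot_free_tail smw.
have ux : uniq (x :: w) by case/andP: uw.
have [aw|aw] := boolP (asc (x :: w)); last first.
  have vx := IH w x sw smx ux aw.
  rewrite blocks_desc // valid_single vx andbT.
  have [P [V [r [e xP]]]] := blocks_cons x w.
  have pP q : q \in P -> q < p.
    move=> qP; case: (peak_to_front e vx qP) => [->//|[y [s1 [s2 [ew h]]]]].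
    have yx : y <= x by move: aw; rewrite ew /= -leqNgt.
    rewrite ew in smw uw; have h' := eqv_cons p h.
    have := rot_free_rot_head (rot_free_eqv h' smw); rewrite (eqv_uniq h') in uw.
    by move: uw; rewrite /= /rot3 !inE; lia.
  apply/allP => t; move: vx; rewrite e mem_letters /=.
  case/and5P=> _ _ _ /allrelP VP /andP[/allrelP Pr _].
  case/or3P=> [/pP//|tV|tr]; last exact: ltn_trans (Pr _ _ xP tr) xp.
  exact: ltn_trans (VP _ _ tV xP) xp.
case: w sw smw uw smx ux aw => // y w sw smw uw smx ux xy.
have noasc a b c s : rot_free [:: a, b & s] -> a < b -> c = b -> ~~ asc (c :: s).
  move=> h ab ->; case: s h => [|z s] // /rot_free_rot_head; rewrite /= /rot3; lia.
have vy : valid (blocks (y :: w)).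
  apply: IH; [by move: sw => /=; lia | exact: rot_free_tail smx | by case/andP: ux |].
  exact: (noasc x y).
have e1 : eqv [:: p, x, y & w] [:: y, x, p & w] by apply: eqv_swap.
have sm2 := rot_free_tail (rot_free_eqv e1 smw).
(* Exchanging [p] and [y] shows that [p] is a peak of the first block of
   [p w], hence exceeds its valleys and all later letters. *)
have vp : valid (blocks (p :: w)).
  apply: IH; [by move: sw => /=; lia | exact: rot_free_tail sm2 | | exact: (noasc x p)].
  by move: uw; rewrite /= !inE !negb_or => /and4P[/and3P[_ _ ->] _ _ ->].
have [P [V [r e]]] := blocks_head w.
have [h1 h2 h3] := first_valley_lt smx ux xy vy (e y).
rewrite blocks_asc // e valid_push ?(sort_sorted geq_total) // -e vy xp h1 h2 h3 /= andbT.
have np : p \notin sort geq (y :: P).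
  apply: contraL uw => pP; have : p \in letters (blocks (y :: w)) by rewrite e mem_letters pP.
  by rewrite (perm_mem (perm_blocks _)) => pyw; rewrite cons_uniq inE pyw orbT.
rewrite np /=; move: vp; rewrite e /= => /and5P[_ _ _ /allrelP VP /andP[/allrelP Pr _]].
have pin : p \in sort geq (p :: P) by rewrite mem_sort inE eqxx.
by apply/andP; split; apply/allP => t ht; [apply: VP | apply: Pr].
Qed.

(** A greatest letter [z] in front allows the word itself to start with an
    ascent. *)
Lemma rot_free_valid_top z w : rot_free w -> uniq w -> all (gtn z) w -> valid (blocks (z :: w)).
Proof.
move=> sm uw zw.
have vdesc : ~~ asc w -> valid (blocks (z :: w)).
  move=> aw; rewrite blocks_desc // valid_single (perm_all _ (perm_blocks w)) zw /=.
  by case: w sm uw aw {zw} => // p w; apply: rot_free_valid.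
have [aw|/vdesc//] := boolP (asc w).
case: w sm uw zw aw {vdesc} => [|x [|y w]] // sm uw zw xy.
have vy : valid (blocks (y :: w)).
  apply: rot_free_valid; [exact: rot_free_tail sm | by case/andP: uw |].
  case: w sm xy {uw zw} => [|t w] // /rot_free_rot_head; rewrite /= /rot3; lia.
have [P [V [r [e _]]]] := blocks_cons y w.
have [h1 h2 h3] := first_valley_lt sm uw xy vy e.
have zl t : t \in letters (blocks (y :: w)) -> t < z.
  by rewrite (perm_mem (perm_blocks _)) => tw; apply: (allP zw); rewrite inE tw orbT.
rewrite blocks_asc // e valid_push ?(blocks_sorted e) // -e vy h1 h2 h3 /= andbT.
have xz : x < z by case/andP: zw.
rewrite xz /=; apply/and3P; split.
- by apply/negP => zP; have := zl z; rewrite e mem_letters zP ltnn => /(_ isT).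
- by apply/allP => t tV; apply: zl; rewrite e mem_letters tV orbT.
- by apply/allP => t tr; apply: zl; rewrite e mem_letters tr !orbT.
Qed.

(** Inserts the valleys [V] between the peaks [P], followed by the word [R]. *)
Fixpoint unp (P V R : seq nat) : seq nat :=
  match P, V with
  | p :: P', v :: V' => [:: p, v & unp P' V' R]
  | p :: P', [::] => p :: R
  | [::], _ => R
  end.

Definition unparse (B : seq block) := foldr (fun b => unp b.1 b.2) [::] B.

Lemma sort_geq_id P : sorted gtn P -> sort geq P = P.
Proof. by rewrite gtn_sorted_uniq_geq => /andP[_]; apply: (sorted_sort geq_trans). Qed.

Lemma sort_geq_swap p q P : p < q -> sorted gtn (q :: P) ->
  sort geq [:: p, q & P] = q :: sort geq (p :: P).
Proof.
move=> pq sq; have qP : all (gtn q) P.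
  by move: sq => /=; apply: order_path_min => x y z /=; lia.
apply: (sorted_eq geq_trans geq_anti).
- exact: sort_sorted geq_total _.
- rewrite /= path_min_sorted ?(sort_sorted geq_total) // all_sort /= ltnW //.
  by apply: sub_all qP => x /ltnW.
rewrite (perm_trans (permEl (perm_sort _ _))) //.
by apply/seq.permP => f /=; rewrite (seq.permP (permEl (perm_sort geq (p :: P)))) /=; lia.
Qed.

(** A peak is moved to its place among decreasing peaks by swaps. *)
Lemma insert_peak p v P V R : sorted gtn P -> size P = (size V).+1 -> p \notin P ->
  v < p -> path ltn v V -> all (ltn v) P -> all (gtn p) V -> allrel ltn V P ->
  eqv [:: p, v & unp P V R] (unp (sort geq (p :: P)) (v :: V) R).
Proof.
elim: P v V => // q P IH v V sP sV pP vp vV vPs pV VP.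
have vq : v < q by case/andP: vPs.
have [qp|pq] := ltnP q p; first by rewrite sort_geq_id; [apply: EqvRefl | rewrite /= qp].
have {}pq : p < q by move: pP; rewrite inE; lia.
rewrite sort_geq_swap //; case: V sV vV pV VP => [|v' V] sV vV pV VP.
  by case: P sV {IH sP pP vPs VP} => //= _; apply: eqv_swap.
move: VP; rewrite allrel_consl allrel_consr => /andP[/= /andP[_ v'P] /andP[_ VP]].
case/andP: vV => _ v'V; case/andP: pV => v'p pV.
apply: eqv_trans (eqv_swap _ vp vq) _; apply/eqv_cons/eqv_cons/IH => //.
- exact: path_sorted sP.
- by case: sV.
- by move: pP; rewrite inE negb_or => /andP[].
Qed.

(** Sorting the peaks of each block does not change the class. *)
Lemma eqv_unparse w : valid (blocks w) -> eqv w (unparse (blocks w)).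
Proof.
elim: {w}(size w).+1 {-2}w (ltnSn (size w)) => // n IH [|p w] sw; first by move=> _; apply: EqvRefl.
have [aw|aw] := boolP (asc w) => vw; last first.
  have vw' := valid_tail_desc aw vw.
  by rewrite blocks_desc //=; apply/eqv_cons/IH.
case: w aw sw vw => // v w aw sw vw.
have vw' := valid_tail_asc aw vw.
have {IH} h : eqv w (unparse (blocks w)) by apply: IH => //; move: sw => /=; lia.
rewrite blocks_asc // in vw *; case: w aw sw vw vw' h => // q w _ _ vw vw' h.
have [P [V [r [e _]]]] := blocks_cons q w; rewrite e in vw vw' h *.
apply: eqv_trans (eqv_cons p (eqv_cons v h)) _ => /=.
move: vw; rewrite valid_push ?(blocks_sorted e) //.
case/and5P => _ pP vp pV /and4P[_ vP vV _].
case/and5P: vw' => sP /eqP sz sV VP _.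
by apply: insert_peak => //; rewrite (path_sortedE ltn_trans) vV.
Qed.

Lemma blocks_unp P V r R : valid ((P, V) :: r) -> blocks R = r ->
  blocks (unp P V R) = (P, V) :: r.
Proof.
move=> + eR; elim: P V => [|p P IH] V vB; first by case/and3P: vB.
case: V vB => [|v V] vB.
  have P0 : P = [::] by case/and3P: vB => _; case: (P).
  subst P; rewrite [unp _ _ _]/= blocks_desc ?eR //; apply: valid_desc.
  by move: vB; rewrite valid_single eR => /andP[].
have spP : sorted gtn (p :: P) by case/andP: vB.
have sP : sorted geq P.
  by have := path_sorted spP; rewrite gtn_sorted_uniq_geq => /andP[].
have : valid (push p v ((P, V) :: r)) by rewrite /push sort_geq_id.
rewrite valid_push // => /and5P[vB' _ _ _ /and4P[_ vP _ _]].
have {}IH := IH V vB'; rewrite [unp _ _ _]/=.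
case: P IH vP vB' spP {sP vB} => [|q P] IH vP vB' spP; first by case/and3P: vB'.
rewrite blocks_asc ?IH /push ?sort_geq_id //.
by case: (V) => [|v' V'] /=; case/andP: vP.
Qed.

Lemma blocks_unparse B : valid B -> blocks (unparse B) = B.
Proof.
elim: B => // -[P V] r IH vB; rewrite [unparse _]/=.
by apply: blocks_unp => //; apply: IH; case/and5P: vB => _ _ _ _ /and3P[].
Qed.

(** * Enumeration of the valid lists of blocks *)

(** Relabels the letters. *)
Definition map_blocks (f : nat -> nat) (B : seq block) : seq block :=
  [seq (map f b.1, map f b.2) | b <- B].

(** Like [push], for a peak [p] that exceeds the others. *)
Definition add_peak p v (B : seq block) : seq block :=
  if B is (P, V) :: r then (p :: P, v :: V) :: r else [::].

(** The letters that a valley added to the first block must not exceed. *)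
Definition tops (B : seq block) :=
  if B is (P, V) :: r then P ++ V ++ next_peaks r else [::].

(** The valid lists of blocks on the letters [1, ..., m].  The greatest letter
    [m] comes first; it is a block of its own, or it is followed by a valley [t]
    of the first block of the rest.  In the latter case the rest is a list on
    [1, ..., m - 2] whose letters from [t] upwards are shifted by one to make
    room for [t]. *)
Fixpoint block_lists (m : nat) : seq (seq block) :=
  if m is m1.+1 then
    if m1 is m2.+1 then
      [seq ([:: m], [::]) :: B | B <- block_lists m1] ++
      [seq add_peak m t (map_blocks (bump t) B)
         | B <- block_lists m2, t <- [seq t <- iota 1 m2 | all (leq t) (tops B)]]
    else [:: [:: ([:: 1], [::])]]
  else [::].

Lemma letters_map f B : letters (map_blocks f B) = map f (letters B).
Proof. by elim: B => // -[P V] r IH; rewrite /letters /= map_cat map_cat -IH. Qed.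

Lemma next_peaks_map f r : next_peaks (map_blocks f r) = map f (next_peaks r).
Proof. by case: r => [|[]]. Qed.

Lemma valid_map f B : {mono f : x y / x < y} -> valid (map_blocks f B) = valid B.
Proof.
move=> fm; elim: B => // -[P V] r IH; rewrite /= IH !size_map letters_map next_peaks_map.
have fg : {mono f : x y / gtn x y} by move=> x y; apply: fm.
rewrite (mono_sorted fg) (mono_sorted (e := ltn) (e' := ltn) fm) !allrel_mapl !allrel_mapr.
do !(congr (_ && _)); apply: eq_allrel => x y //=; exact: fm.
Qed.

Lemma block_listsP m B : reflect
  ((exists2 B', B' \in block_lists m.+1 & B = ([:: m.+2], [::]) :: B') \/
   (exists B' t, [/\ B' \in block_lists m, 0 < t <= m, all (leq t) (tops B')
      & B = add_peak m.+2 t (map_blocks (bump t) B')]))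
  (B \in block_lists m.+2).
Proof.
rewrite [block_lists _]/= -/(block_lists m.+1) mem_cat.
apply: (iffP orP) => [[/mapP[B' h ->]|/allpairsPdep[B' [t []]]]|[[B' h ->]|[B' [t [h1 h2 h3 h4]]]]].
- by left; exists B'.
- rewrite mem_filter mem_iota add1n ltnS => h /andP[h1 h2] ->.
  by right; exists B', t.
- by left; apply: map_f.
- right; apply/allpairsPdep; exists B', t; split=> //.
  by rewrite mem_filter mem_iota add1n ltnS h2 h3.
Qed.

Lemma bump_mono t : {mono bump t : x y / x < y}.
Proof. by move=> x y; rewrite /bump; lia. Qed.

Lemma bump_inj t : injective (bump t).
Proof. exact: can_inj (bumpK t). Qed.

Lemma perm_bump_iota t m : 0 < t <= m.+1 ->
  perm_eq (t :: map (bump t) (iota 1 m)) (iota 1 m.+1).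
Proof.
move=> ht; apply: uniq_perm; last 1 first.
- move=> x; rewrite inE mem_iota; apply/orP/idP => [[/eqP->|/mapP[y]]|hx]; first by lia.
    by rewrite mem_iota => hy ->; rewrite /bump; lia.
  have [->|xt] := eqVneq x t; [by left | right].
  apply/mapP; exists (unbump t x); last by rewrite unbumpKcond (negbTE xt).
  by rewrite mem_iota /unbump; lia.
- rewrite /= map_inj_uniq ?iota_uniq ?andbT; last exact: bump_inj.
  by apply/mapP => -[y _]; rewrite /bump; lia.
- exact: iota_uniq.
Qed.

Lemma letters_add_peak p v B : B != [::] ->
  perm_eq (letters (add_peak p v B)) [:: p, v & letters B].
Proof.
case: B => // -[P V] r _; rewrite /letters /=; apply/seq.permP => f.
by rewrite /= !count_cat /=; lia.
Qed.

Lemma map_blocks_nil f B : (map_blocks f B == [::]) = (B == [::]).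
Proof. by case: B. Qed.

Lemma add_peak_push p v P V r : sorted gtn (p :: P) ->
  add_peak p v ((P, V) :: r) = push p v ((P, V) :: r).
Proof. by move=> s; rewrite /push sort_geq_id. Qed.

Lemma perm_add_peak m t B : B != [::] -> 0 < t <= m.+1 -> perm_eq (letters B) (iota 1 m) ->
  perm_eq (letters (add_peak m.+2 t (map_blocks (bump t) B))) (iota 1 m.+2).
Proof.
move=> B0 ht pB; rewrite -(map_blocks_nil (bump t)) in B0.
rewrite (perm_trans (letters_add_peak _ _ B0)) // letters_map.
rewrite [iota 1 m.+2]iota_rcons add1n.
rewrite perm_sym perm_rcons perm_cons perm_sym.
by rewrite (perm_trans _ (perm_bump_iota ht)) // perm_cons perm_map.
Qed.

Lemma tops_letters B x : x \in tops B -> x \in letters B.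
Proof.
case: B => // -[P V] r; rewrite mem_letters [tops _]/= !mem_cat.
by case/or3P=> [->//|->|/next_letters->]; rewrite ?orbT.
Qed.

Lemma block_lists_spec m B : B \in block_lists m ->
  [/\ valid B, perm_eq (letters B) (iota 1 m) & B != [::]].
Proof.
elim: {m}m.+1 {-2}m B (ltnSn m) => // n IH [|[|m]] B hm //; first by rewrite inE => /eqP->.
case/block_listsP => [[B' h ->]|[B' [t [h ht tB ->]]]].
  have [|vB pB _] := IH m.+1 B' _ h; first by lia.
  split=> //.
    by rewrite valid_single vB (perm_all _ pB) andbT; apply/allP => x; rewrite mem_iota /=; lia.
  rewrite [iota 1 m.+2]iota_rcons add1n.
  by rewrite perm_sym perm_rcons /letters /= perm_cons perm_sym.
have [|vB pB B0] := IH m B' _ h; first by lia.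
split; last 1 first.
- by case: (B') B0 => // -[].
- case: B' B0 vB pB tB {h} => // -[P V] r _ vB pB tB.
  have lm x : x \in letters ((P, V) :: r) -> bump t x < m.+2.
    by rewrite (perm_mem pB) mem_iota /bump; lia.
  have sP : sorted gtn (map (bump t) P).
    rewrite (mono_sorted (e := gtn)); last by move=> x y; apply: bump_mono.
    by case/andP: vB.
  have Plt : all (gtn m.+2) (map (bump t) P).
    by apply/allP => _ /mapP[x xP ->]; apply: (lm x); rewrite mem_letters xP.
  have sP' : sorted gtn (m.+2 :: map (bump t) P).
    by rewrite /= (path_min_sorted Plt).
  rewrite [map_blocks _ _]/= add_peak_push // valid_push; last first.
    by move: sP; rewrite gtn_sorted_uniq_geq => /andP[].
  have -> : valid ((map (bump t) P, map (bump t) V) :: map_blocks (bump t) r).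
    by rewrite -[X in valid X]/(map_blocks (bump t) ((P, V) :: r)) (valid_map _ (@bump_mono t)).
  have bt s : {subset s <= tops ((P, V) :: r)} -> all (ltn t) (map (bump t) s).
    move=> sub; apply/allP => _ /mapP[x /sub xs ->].
    by have := allP tB x xs; rewrite /= /bump; lia.
  rewrite next_peaks_map letters_map !bt; try by move=> x xs; rewrite /= !mem_cat xs ?orbT.
  rewrite !andbT /=; apply/and4P; split.
  + by apply/negP => /(allP Plt) /=; rewrite ltnn.
  + by lia.
  + by apply/allP => _ /mapP[x xV ->]; apply: (lm x); rewrite mem_letters xV orbT.
  + by apply/allP => _ /mapP[x xr ->]; apply: (lm x); rewrite mem_letters xr !orbT.
- by apply: perm_add_peak => //; lia.
Qed.

Lemma block_lists_complete m B : 0 < m -> valid B -> perm_eq (letters B) (iota 1 m) ->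
  B \in block_lists m.
Proof.
elim: {m}m.+1 {-2}m B (ltnSn m) => // n IH m B hm m0 vB pB.
have uB : uniq (letters B) by rewrite (perm_uniq pB) iota_uniq.
have mB x : x \in letters B = (0 < x <= m) by rewrite (perm_mem pB) mem_iota add1n ltnS.
case: B vB pB uB mB => [|[P V] r]; first by move=> _ /perm_size; rewrite size_iota /=; lia.
case: P => [|p P] vB pB uB mB; first by case/and3P: vB.
have spP : sorted gtn (p :: P) by case/andP: vB.
have ppP : all (gtn p) P by move: spP; apply: order_path_min => x y z /=; lia.
have pmax : p = m.
  have pin : p \in letters ((p :: P, V) :: r) by rewrite mem_letters inE eqxx.
  apply/eqP; rewrite eqn_leq; apply/andP; split; first by move: pin; rewrite mB => /andP[].
  have : m \in letters ((p :: P, V) :: r) by rewrite mB m0 leqnn.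
  case/and5P: (vB) => _ _ _ /allrelP VP /andP[/allrelP Pr _].
  have pp : p \in p :: P by rewrite inE eqxx.
  rewrite mem_letters inE => /or3P[/orP[/eqP->//|/(allP ppP)]|mV|mr].
  - by move/ltnW.
  - by apply: ltnW; apply: VP.
  - by apply: ltnW; apply: Pr.
subst p; case: V vB pB uB mB => [|v V] vB pB uB mB.
  have P0 : P = [::] by case/and3P: vB => _; case: (P).
  subst P; move: vB; rewrite valid_single => /andP[mr vr].
  have pr : perm_eq (letters r) (iota 1 m.-1).
    rewrite -(perm_cons m) -[m :: letters r]/(letters (([:: m], [::]) :: r)) (perm_trans pB) //.
    by case: (m) m0 => // k _; rewrite iota_rcons perm_rcons add1n.
  case: m {spP ppP uB} m0 hm mr pB mB pr => // -[|m] _ hm mr pB mB pr.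
    have r0 : letters r = [::] by apply/perm_nilP.
    by case: r r0 vr {mr pB mB pr} => // -[[|x P] V] r r0; case/and3P.
  apply/block_listsP; left; exists r => //; apply: IH => //; lia.
have : valid (push m v ((P, V) :: r)) by rewrite -add_peak_push.
rewrite valid_push; last by have := path_sorted spP; rewrite gtn_sorted_uniq_geq => /andP[].
case/and5P=> vB0 mP vm _ /and4P[_ vP vV vn].
have B0 : (P, V) :: r != [::] by [].
have pl := letters_add_peak m v B0.
set B1 := (P, V) :: r in vB0 B0 pl.
have eB : (m :: P, v :: V) :: r = add_peak m v B1 by [].
rewrite eB in pB uB mB *.
have u3 : uniq [:: m, v & letters B1] by rewrite -(perm_uniq pl).
have v0 : 0 < v <= m by rewrite -mB (perm_mem pl) !inE eqxx orbT.
case: m m0 hm {spP ppP vB mP} vm pB uB mB pl eB u3 v0 => // -[|m] _ hm vm pB uB mB pl eB u3 v0.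
  by move: vm; rewrite ltnS leqNgt; case/andP: v0 => ->.
pose B' := map_blocks (unbump v) B1.
have eB1 : B1 = map_blocks (bump v) B'.
  have bumpE s : {subset s <= letters B1} -> map (bump v) (map (unbump v) s) = s.
    move=> sub; rewrite -map_comp -[RHS]map_id; apply/eq_in_map => x /sub xs /=.
    rewrite unbumpKcond; case: eqP => // e; exfalso.
    by move: u3; rewrite /= -e xs andbF.
  rewrite /B' /map_blocks -map_comp -[LHS]map_id; apply/eq_in_map => -[P1 V1] h /=.
  have sub s : {subset s <= P1 ++ V1} -> {subset s <= letters B1}.
    by move=> ss x /ss xs; apply/flatten_mapP; exists (P1, V1).
  by rewrite !bumpE //; apply: sub => x xs; rewrite mem_cat xs ?orbT.
have B'0 : B' != [::] by rewrite map_blocks_nil.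
have pB' : perm_eq (letters B') (iota 1 m).
  apply: (perm_map_inj (@bump_inj v)).
  rewrite -letters_map -eB1 -(perm_cons v) -(perm_cons m.+2).
  have e1 : perm_eq [:: m.+2, v & letters B1] (iota 1 m.+2).
    by rewrite (perm_trans _ pB) // perm_sym.
  apply: perm_trans e1 _; rewrite [iota 1 m.+2]iota_rcons add1n perm_rcons perm_cons perm_sym.
  by apply: perm_bump_iota; case/andP: v0 => ->.
have tB' : all (leq v) (tops B').
  have e : tops B' = map (unbump v) (tops B1).
    by rewrite /B' /= !map_cat -next_peaks_map.
  rewrite e all_map; apply/allP => x; rewrite /= !mem_cat => xin.
  have : v < x by case/or3P: xin; [apply: (allP vP) | apply: (allP vV) | apply: (allP vn)].
  by rewrite /unbump => vx; rewrite vx; case: (x) vx => // y; rewrite subn1.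
have vB' : valid B' by rewrite -(valid_map _ (@bump_mono v)) -eB1.
apply/block_listsP; right; exists B', v; split=> //; last by rewrite -eB1.
- apply: IH => //; first exact: ltnW.
  by case: (m) pB' vB' B'0 => //; case: (B') => // -[[|? ?] ?] ? /perm_size.
case: B' B'0 vB' tB' pB' {eB1} => // -[[|x P'] V'] r' _; first by case/and3P.
move=> _ /andP[vx _] pB'.
have : x \in letters ((x :: P', V') :: r') by rewrite mem_letters inE eqxx.
rewrite (perm_mem pB') mem_iota add1n ltnS => /andP[_ xm].
by case/andP: v0 => -> _; apply: leq_trans xm.
Qed.

Lemma map_blocks_inj f : injective f -> injective (map_blocks f).
Proof.
move=> fi; apply: inj_map => -[P V] [P' V'] /= [].
by move=> /(inj_map fi) -> /(inj_map fi) ->.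
Qed.

Lemma block_lists_uniq m : uniq (block_lists m).
Proof.
elim: {m}m.+1 {-2}m (ltnSn m) => // n IH [|[|m]] hm //.
rewrite [block_lists _]/= -/(block_lists m.+1) cat_uniq; apply/and3P; split.
- by rewrite map_inj_uniq; [apply: IH; lia | move=> B1 B2 []].
- apply/hasPn => _ /allpairsPdep[B [t [hB _ ->]]]; apply/mapP => -[B' _].
  by have [_ _] := block_lists_spec hB; case: (B) => // -[].
apply: allpairs_uniq_dep.
- by apply: IH; lia.
- by move=> B _; rewrite filter_uniq // iota_uniq.
move=> [B1 t1] [B2 t2] /allpairsPdep[B [t [hB _ [-> ->]]]].
move=> /allpairsPdep[B' [t' [hB' _ [-> ->]]]] /=.
have [_ _] := block_lists_spec hB; have [_ _] := block_lists_spec hB'.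
case: B hB => // -[P V] r _; case: B' hB' => // -[P' V'] r' _ _ _ /=.
move=> [eP et eV er]; subst t'.
have : map_blocks (bump t) ((P, V) :: r) = map_blocks (bump t) ((P', V') :: r').
  by rewrite /= eP eV er.
by move/(map_blocks_inj (@bump_inj t)) => ->.
Qed.

(** * Counting by the number of peaks of the first block *)

Definition num_peaks (B : seq block) := size (next_peaks B).

(** The peaks of the first block are the greatest letters. *)
Lemma block_lists_peaks m B : B \in block_lists m ->
  0 < num_peaks B <= m /\
  next_peaks B = rev (iota (m.+1 - num_peaks B) (num_peaks B)).
Proof.
elim: {m}m.+1 {-2}m B (ltnSn m) => // n IH [|[|m]] B hm //; first by rewrite inE => /eqP->.
case/block_listsP => [[B' h ->]|[B' [t [h ht tB ->]]]].
  by rewrite /num_peaks /= subn1.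
have [|/andP[k0 km] ek] := IH m B' _ h; first by lia.
case: B' h tB k0 km ek => // -[P V] r _; rewrite /num_peaks /= => tB k0 km ek.
rewrite size_map; split; first by rewrite ltnS (leq_trans km).
have -> : map (bump t) P = map S P.
  apply/eq_in_map => x xP; have := allP tB x; rewrite mem_cat xP => /(_ isT).
  by rewrite /bump => ->.
rewrite [in LHS]ek map_rev -(iotaDl 1).
move: (size P) k0 km => s k0 km; rewrite -[_ :: iota _ s]/(iota _ s.+1) iota_rcons rev_rcons.
by congr (_ :: rev (iota _ _)); lia.
Qed.

Lemma block_lists_peaks_ge m B t : B \in block_lists m ->
  all (leq t) (next_peaks B) = (num_peaks B + t <= m.+1).
Proof.
move=> /block_lists_peaks[/andP[k0 km] ->]; rewrite all_rev.
apply/allP/idP => [/(_ (m.+1 - num_peaks B))|h x].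
  by rewrite mem_iota /= => /(_ ltac:(lia)); lia.
by rewrite mem_iota /=; lia.
Qed.

(** The number of valid lists on [1, ..., m] with [k] peaks in the first
    block. *)
Definition num_lists m k := count (fun B => num_peaks B == k) (block_lists m).

(** The number of those lists in whose first block a valley [t] can be added. *)
Definition num_lists_above m k t :=
  count (fun B => (num_peaks B == k) && all (leq t) (tops B)) (block_lists m).

Lemma count_flatten_map (T U : Type) (p : pred U) (f : T -> seq U) (s : seq T) :
  count p (flatten (map f s)) = \sum_(x <- s) count p (f x).
Proof. by elim: s => [|x s IH]; rewrite ?big_nil //= big_cons count_cat IH. Qed.

Lemma count_leq_sum (T : eqType) (s : seq T) (f : T -> nat) b :
  {in s, forall x, 0 < f x} ->
  count (fun x => f x <= b) s = \sum_(1 <= j < b.+1) count (fun x => f x == j) s.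
Proof.
move=> fs; rewrite -sum1_count big_mkcond /=.
under [RHS]eq_bigr do rewrite -sum1_count big_mkcond /=.
rewrite exchange_big /=; apply: eq_big_seq => x xs; rewrite -big_mkcond /=.
rewrite sum1_count; case: ifP => h.
  rewrite (eq_count (a2 := pred1 (f x))); last by move=> j /=; rewrite eq_sym.
  by rewrite count_uniq_mem ?iota_uniq // mem_index_iota ltnS h fs.
rewrite (eq_in_count (a2 := pred0)) ?count_pred0 // => j.
by rewrite mem_index_iota /=; lia.
Qed.

(** When the first block is the greatest letter alone, only the [j] peaks of the
    second block matter; they are the [j] greatest remaining letters. *)
Lemma num_lists_above_one m t : 0 < m ->
  num_lists_above m.+1 1 t = \sum_(1 <= j < (m.+1 - t).+1) num_lists m j.
Proof.
case: m => // m _; rewrite /num_lists_above [block_lists _]/= -/(block_lists m.+1) count_cat.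
rewrite [X in _ + X = _](_ : _ = 0) ?addn0; last first.
  apply/eqP; rewrite -leqn0 leqNgt -has_count; apply/hasPn => _ /allpairsPdep[B [u [hB _ ->]]].
  have [] := block_lists_peaks hB; case: (B) => // -[P V] r.
  by rewrite /num_peaks /= size_map; case: (size P).
rewrite count_map /num_lists -count_leq_sum; last by move=> B /block_lists_peaks[/andP[]].
apply: eq_in_count => B hB /=; rewrite (block_lists_peaks_ge _ hB).
by have [/andP[k0 _] _] := block_lists_peaks hB; lia.
Qed.

(** The valley [u] added last is the least letter to compare with. *)
Lemma num_lists_above_step m k t : 0 < k ->
  num_lists_above m.+2 k.+1 t = \sum_(1 <= u < m.+1 | t <= u) num_lists_above m k u.
Proof.
move=> k0; rewrite /num_lists_above [block_lists _]/= -/(block_lists m.+1) count_cat.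
rewrite [X in X + _](_ : _ = 0) ?add0n; last first.
  rewrite count_map (eq_count (a2 := pred0)) ?count_pred0 // => B /=.
  by rewrite /num_peaks /=; case: k k0.
rewrite count_flatten_map.
under [RHS]eq_bigr do rewrite -sum1_count big_mkcond /=.
rewrite exchange_big /=; apply: eq_big_seq => B hB.
rewrite count_map count_filter -sum1_count /index_iota subn1 /= [LHS]big_mkcond [RHS]big_mkcond /=.
apply: eq_big_seq => u; rewrite mem_iota => hu.
have [_] := block_lists_peaks hB.
case: (B) => [|[P V] r] _.
  by rewrite /num_peaks /=; case: (k) k0 => // k' _; rewrite !if_same.
rewrite /num_peaks /= size_map eqSS; case: (size P == k); rewrite ?andbF ?if_same //=.
have [h|] := boolP (all (leq u) (P ++ V ++ next_peaks r)); rewrite ?andbF ?if_same // andbT.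
suff -> : (t <= m.+2) && all (leq t) (map (bump u) P ++
    u :: map (bump u) V ++ next_peaks (map_blocks (bump u) r)) = (t <= u) by [].
rewrite next_peaks_map all_cat /= all_cat; apply/idP/idP => [/and4P[]//|tu].
have tm : t <= m.+2 by lia.
have ub s : all (leq u) s -> all (leq t) (map (bump u) s).
  by move=> us; rewrite all_map; apply: sub_all us => x /= ux; rewrite /bump; lia.
move: h; rewrite !all_cat => /and3P[h1 h2 h3].
by rewrite tm tu !ub.
Qed.

Lemma hockey_stick k t u : t <= u ->
  \sum_(t <= s < u.+1) 'C(u - s + k, k) = 'C(u - t + k.+1, k.+1).
Proof.
move=> tu; have [d ->] : exists d, u = d + t by exists (u - t); rewrite subnK.
elim: d t {u tu} => [|d IH] t.
  by rewrite add0n big_nat1 subnn !add0n !binn.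
rewrite big_ltn; last by lia.
rewrite addSnnS IH; have -> : d + t.+1 - t = d.+1 by lia.
have -> : d + t.+1 - t.+1 = d by lia.
by rewrite [in RHS]addSn [in RHS]binS [in RHS]addnC addSnnS.
Qed.

(** Iterating the previous step, the binomial coefficient counts the choices
    [t <= u_1 <= ... <= u_k <= u] of the successive valleys before shifting. *)
Lemma num_lists_above_formula m k t : 0 < t ->
  num_lists_above (m + k.+1.*2) k.+2 t =
    \sum_(1 <= u < m.+1 | t <= u) 'C(u - t + k, k) * num_lists_above m 1 u.
Proof.
elim: k t => [|k IH] t t0.
  rewrite addn2 num_lists_above_step //; apply: eq_bigr => u _.
  by rewrite bin0 mul1n.
have -> : m + k.+2.*2 = (m + k.+1.*2).+2 by rewrite (doubleS k.+1) !addnS.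
rewrite num_lists_above_step //.
rewrite big_mkcond (eq_big_nat _ _ (F2 := fun s => \sum_(1 <= u < m.+1)
    (if t <= s <= u then 'C(u - s + k, k) * num_lists_above m 1 u else 0))); last first.
  move=> s /andP[s0 _]; case: leqP => ts; last by rewrite big1.
  by rewrite IH // big_mkcond.
rewrite exchange_big /= [RHS]big_mkcond /=; apply: eq_big_nat => u /andP[u0 um].
rewrite -big_mkcond /= -big_distrl /=.
have [tu|ut] := leqP t u; last first.
  by rewrite big1 // => s /andP[]; lia.
congr (_ * _); rewrite -hockey_stick //.
rewrite [RHS](big_nat_widenl t 1) // [RHS](big_nat_widen _ _ (m + k.+1.*2).+1); last by lia.
by apply: eq_bigl => s; rewrite ltnS.
Qed.

Lemma num_lists_above1 m k : num_lists_above m k 1 = num_lists m k.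
Proof.
apply: eq_in_count => B /block_lists_spec[_ pB _].
have -> : all (leq 1) (tops B); last by rewrite andbT.
by apply/allP => x /tops_letters; rewrite (perm_mem pB) mem_iota => /andP[].
Qed.

Lemma num_lists_above_eq0 m k t : m.+1 < k.*2 -> num_lists_above m k t = 0.
Proof.
elim: k m t => // k IH [|[|m]] t h //.
  by rewrite /num_lists_above /num_peaks /=; case: k h {IH} => //= k; lia.
rewrite num_lists_above_step; last by lia.
by rewrite big1 // => u _; apply: IH; lia.
Qed.

Lemma num_lists_eq0 m k : m.+1 < k.*2 -> num_lists m k = 0.
Proof. by rewrite -num_lists_above1; apply: num_lists_above_eq0. Qed.

Lemma num_lists_g m k : 0 < k <= m -> num_lists m k = g m k.
Proof.
elim: {m}m.+1 {-2}m k (ltnSn m) => // n IH m k hm /andP[k0 km].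
have [m1|m1] := eqVneq m 1.
  by subst m; have -> : k = 1 by lia.
rewrite gE //; last by lia.
rewrite (negbTE m1) /=; have [mk|mk] := eqVneq (m + 1) (2 * k).
  have k1 : 1 < k by lia.
  have [k2 ek] : exists k2, k = k2.+2 by exists (k - 2); rewrite -[RHS]addn2 subnK.
  have -> : m = 1 + k2.+1.*2 by lia.
  rewrite ek -num_lists_above1 num_lists_above_formula // big_mkcond big_nat1 /=.
  by rewrite subnn add0n binn.
have [k1|k1] := eqVneq k 1.
  have [m2 em] : exists m2, m = m2.+2 by exists (m - 2); rewrite -[RHS]addn2 subnK //; lia.
  rewrite k1 em -num_lists_above1 num_lists_above_one //.
  have -> : m2.+2 - 1 = m2.+1 by [].
  rewrite (big_cat_nat (n := (((m2.+2 + 1) %/ 2).+1))); try by lia.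
  rewrite [X in _ + X = _](_ : _ = 0) ?addn0; last first.
    by rewrite big_nat_cond big1 // => j hj; apply: num_lists_eq0; lia.
  by apply: eq_big_nat => j hj; apply: IH; lia.
have [k2 ek] : exists k2, k = k2.+2 by exists (k - 2); rewrite -[RHS]addn2 subnK //; lia.
have [mk'|mk'] := ltnP (m + 1) (2 * k).
  rewrite num_lists_eq0 ?big_geq //; lia.
have [m2 em] : exists m2, m = m2.+2 + k2.+1.*2 by exists (m - k2.+2.*2); lia.
rewrite ek em -num_lists_above1 num_lists_above_formula //.
have -> : m2.+2 + k2.+1.*2 + 1 - 2 * k2.+2 = m2.+1 by lia.
have -> : k2.+2 - 2 = k2 by lia.
rewrite -[in RHS](addn0 (k2.+2 - 1)).
have -> : k2.+2 - 1 + 0 = 1 + k2 by lia.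
have -> : (m2.+2 + k2.+1.*2 - k2.+2).+1 = m2.+3 + k2 by lia.
rewrite -{2}[k2]/(0 + k2) [RHS]big_addn addnK big_mkcond; apply: eq_big_nat => u hu.
have -> : (0 < u) by lia.
have -> : m2.+2 + k2.+1.*2 - k2.+2 - (u + k2) = m2.+2 - u by lia.
have -> : u + k2 - 1 = u - 1 + k2 by lia.
rewrite num_lists_above_one // big_distrr /=; apply: eq_big_nat => j hj.
by rewrite IH //; lia.
Qed.

Lemma size_block_lists m : size (block_lists m) = \sum_(1 <= k < m.+1) num_lists m k.
Proof.
rewrite -count_leq_sum; last by move=> B /block_lists_peaks[/andP[]].
apply/esym/eqP; rewrite -all_count; apply/allP => B.
by move=> /block_lists_peaks[/andP[]].
Qed.

Lemma size_block_lists_g n : 0 < n ->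
  size (block_lists n.+1) = \sum_(1 <= k < (n %/ 2 + 1).+1) g n.+1 k.
Proof.
move=> n0; rewrite size_block_lists (big_cat_nat (n := (n %/ 2 + 1).+1)); try by lia.
rewrite [X in _ + X = _](_ : _ = 0) ?addn0; last first.
  by rewrite big_nat_cond big1 // => j hj; apply: num_lists_eq0; lia.
by apply: eq_big_nat => j hj; apply: num_lists_g; lia.
Qed.

(** * From permutations to words *)

Lemma nth_word n (s : 'S_n) (i : 'I_n) : nth 0 (word s) i = (s i).+1.
Proof. by rewrite (nth_map i) ?size_enum_ord // nth_ord_enum. Qed.

Lemma word_inj n : injective (@word n).
Proof.
move=> s t e; apply/permP => i; apply/val_inj/succn_inj.
by rewrite -!nth_word e.
Qed.

Lemma perm_word n (s : 'S_n) : perm_eq (word s) (iota 1 n).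
Proof.
have us : uniq (word s).
  by rewrite map_inj_uniq ?enum_uniq // => i j /succn_inj/val_inj/perm_inj.
have sub : {subset word s <= iota 1 n}.
  by move=> _ /mapP[i _ ->]; rewrite mem_iota /= add1n ltnS ltn_ord.
apply: uniq_perm => //; first exact: iota_uniq.
by have [] := uniq_min_size us sub; rewrite ?size_word ?size_iota.
Qed.

Lemma word_surj n w : perm_eq w (iota 1 n) -> exists s : 'S_n, word s = w.
Proof.
move=> pw; have sw : size w = n by rewrite (perm_size pw) size_iota.
have uw : uniq w by rewrite (perm_uniq pw) iota_uniq.
have wn (i : 'I_n) : 0 < nth 0 w i <= n.
  have : nth 0 w i \in w by rewrite mem_nth ?sw.
  by rewrite (perm_mem pw) mem_iota add1n ltnS.
have fP (i : 'I_n) : (nth 0 w i).-1 < n by have := wn i; case: (nth _ _ _).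
have fi : injective (fun i => Ordinal (fP i)).
  move=> i j [] e; apply/val_inj/eqP; rewrite -(nth_uniq 0 _ _ uw) ?sw ?ltn_ord //; apply/eqP.
  have /andP[hi _] := wn i; have /andP[hj _] := wn j.
  by rewrite -(prednK hi) e prednK.
exists (perm fi); apply: (@eq_from_nth _ 0) => [|i]; first by rewrite size_word sw.
rewrite size_word => hi; rewrite (nth_word _ (Ordinal hi)) permE /=.
by have /andP[h _] := wn (Ordinal hi); rewrite prednK.
Qed.

(** Order permutations compared through their one-line notation. *)
Lemma order_permP c u (s : 'S_c) : reflect
  [/\ size u = c, uniq u & forall i j, i < c -> j < c ->
     (nth 0 (word s) i < nth 0 (word s) j) = (nth 0 u i < nth 0 u j)]
  (is_order_perm u s).
Proof.
apply: (iffP and3P) => [[/eqP su uu /forallP h]|[su uu h]]; split=> //; try exact/eqP.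
  move=> i j hi hj; have /forallP/(_ (Ordinal hj))/eqP <- := h (Ordinal hi).
  by rewrite (nth_word s (Ordinal hi)) (nth_word s (Ordinal hj)).
apply/forallP => i; apply/forallP => j; apply/eqP.
by rewrite -(h i j) // !nth_word.
Qed.

(** Three comparisons determine the order type of a three-letter word. *)
Lemma order3P x y z (s : 'S_3) p q r : word s = [:: p; q; r] -> reflect
  [/\ uniq [:: x; y; z], (x < y) = (p < q), (y < z) = (q < r) & (x < z) = (p < r)]
  (is_order_perm [:: x; y; z] s).
Proof.
move=> ws; have us : uniq [:: p; q; r] by rewrite -ws (perm_uniq (perm_word s)) iota_uniq.
apply: (iffP (order_permP _ _)); rewrite ws => -[].
  by move=> _ uu h; split=> //; [rewrite -(h 0 1) | rewrite -(h 1 2) | rewrite -(h 0 2)].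
move=> uu h1 h2 h3; split=> // i j.
move: us uu; rewrite /= !inE.
by case: i => [|[|[|i]]] //; case: j => [|[|[|j]]] //=; lia.
Qed.

Ltac order3 := let H := fresh in intro H; apply/(order3P _ _ _ H)/idP; rewrite /= !inE;
  [case | move=> ?; split]; lia.

Lemma order123 x y z (s : 'S_3) : word s = [:: 1; 2; 3] ->
  is_order_perm [:: x; y; z] s = (x < y < z).
Proof. order3. Qed.
Lemma order231 x y z (s : 'S_3) : word s = [:: 2; 3; 1] ->
  is_order_perm [:: x; y; z] s = (z < x < y).
Proof. order3. Qed.
Lemma order213 x y z (s : 'S_3) : word s = [:: 2; 1; 3] ->
  is_order_perm [:: x; y; z] s = (y < x < z).
Proof. order3. Qed.
Lemma order312 x y z (s : 'S_3) : word s = [:: 3; 1; 2] ->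
  is_order_perm [:: x; y; z] s = (y < z < x).
Proof. order3. Qed.
Lemma order132 x y z (s : 'S_3) : word s = [:: 1; 3; 2] ->
  is_order_perm [:: x; y; z] s = (x < z < y).
Proof. order3. Qed.
Lemma order321 x y z (s : 'S_3) : word s = [:: 3; 2; 1] ->
  is_order_perm [:: x; y; z] s = (z < y < x).
Proof. order3. Qed.

Lemma size3 (T : Type) (u : seq T) : size u = 3 -> exists x y z, u = [:: x; y; z].
Proof. by case: u => [|x [|y [|z []]]] // _; exists x, y, z. Qed.

(** The letters being the same, sorting both words determines one from the
    other. *)
Lemma same_part_eqv u v : same_part K_123_231_213_312 u v -> perm_eq u v -> eqv u v.
Proof.
move=> spuv puv; have [su sv] := same_part_size spuv.
have [x [y [z eu]]] := size3 su; have [x' [y' [z' ev]]] := size3 sv; subst u v.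
case/existsP: spuv => B /andP[BK /existsP[s /andP[sB /existsP[t /and3P[tB us vt]]]]].
have es := sort_perm puv.
have srt a b c w : a < b < c -> perm_eq w [:: a; b; c] -> sort leq w = [:: a; b; c].
  by case/andP=> ab bc pw; rewrite (sort_perm pw) sort_id //= ab bc.
have p231 a b c : perm_eq [:: a; b; c] [:: c; a; b] by apply/seq.permP => f /=; lia.
have p213 a b c : perm_eq [:: a; b; c] [:: b; a; c] by apply/seq.permP => f /=; lia.
have p312 a b c : perm_eq [:: a; b; c] [:: b; c; a] by apply/seq.permP => f /=; lia.
have p132 a b c : perm_eq [:: a; b; c] [:: a; c; b] by apply/seq.permP => f /=; lia.
have p321 a b c : perm_eq [:: a; b; c] [:: c; b; a] by apply/seq.permP => f /=; lia.
move: BK; rewrite /K_123_231_213_312 !inE -!orbA => /or4P[]/eqP eB; subst B.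
- move: sB tB; rewrite !inE => /orP[]/eqP es' /orP[]/eqP et'; move: us vt es.
  + rewrite (order123 _ _ _ es') (order123 _ _ _ et') => h1 h2.
    by rewrite (srt _ _ _ _ h1) ?(srt _ _ _ _ h2) // => -[-> -> ->]; apply: EqvRefl.
  + rewrite (order123 _ _ _ es') (order231 _ _ _ et') => h1 h2.
    rewrite (srt _ _ _ _ h1) ?(srt _ _ _ _ h2) // => -[ex ey ez]; subst.
    by case/andP: h1; apply: eqv_rot.
  + rewrite (order231 _ _ _ es') (order123 _ _ _ et') => h1 h2.
    rewrite (srt _ _ _ _ h1) ?(srt _ _ _ _ h2) // => -[ex ey ez]; subst.
    by case/andP: h1 => *; apply/eqv_sym/eqv_rot.
  + rewrite (order231 _ _ _ es') (order231 _ _ _ et') => h1 h2.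
    by rewrite (srt _ _ _ _ h1) ?(srt _ _ _ _ h2) // => -[-> -> ->]; apply: EqvRefl.
- move: sB tB; rewrite !inE => /orP[]/eqP es' /orP[]/eqP et'; move: us vt es.
  + rewrite (order213 _ _ _ es') (order213 _ _ _ et') => h1 h2.
    by rewrite (srt _ _ _ _ h1) ?(srt _ _ _ _ h2) // => -[-> -> ->]; apply: EqvRefl.
  + rewrite (order213 _ _ _ es') (order312 _ _ _ et') => h1 h2.
    rewrite (srt _ _ _ _ h1) ?(srt _ _ _ _ h2) // => -[ex ey ez]; subst.
    by apply: eqv_swap; lia.
  + rewrite (order312 _ _ _ es') (order213 _ _ _ et') => h1 h2.
    rewrite (srt _ _ _ _ h1) ?(srt _ _ _ _ h2) // => -[ex ey ez]; subst.
    by apply: eqv_swap; lia.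
  + rewrite (order312 _ _ _ es') (order312 _ _ _ et') => h1 h2.
    by rewrite (srt _ _ _ _ h1) ?(srt _ _ _ _ h2) // => -[-> -> ->]; apply: EqvRefl.
- move: sB tB; rewrite !inE => /eqP es' /eqP et'; move: us vt es.
  rewrite (order132 _ _ _ es') (order132 _ _ _ et') => h1 h2.
  by rewrite (srt _ _ _ _ h1) ?(srt _ _ _ _ h2) // => -[-> -> ->]; apply: EqvRefl.
- move: sB tB; rewrite !inE => /eqP es' /eqP et'; move: us vt es.
  rewrite (order321 _ _ _ es') (order321 _ _ _ et') => h1 h2.
  by rewrite (srt _ _ _ _ h1) ?(srt _ _ _ _ h2) // => -[-> -> ->]; apply: EqvRefl.
Qed.

Lemma same_part_rot a b c : a < b -> b < c ->
  same_part K_123_231_213_312 [:: a; b; c] [:: b; c; a].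
Proof.
move=> ab bc; apply/existsP; exists (perms_of_words 3 [:: [:: 1; 2; 3]; [:: 2; 3; 1]]).
rewrite /K_123_231_213_312 !inE eqxx /=.
have [s es] : exists s : 'S_3, word s = [:: 1; 2; 3] by apply: word_surj.
have [t et] : exists t : 'S_3, word t = [:: 2; 3; 1] by apply: word_surj.
apply/existsP; exists s; rewrite !inE es eqxx /=; apply/existsP; exists t.
by rewrite !inE et eqxx orbT (order123 _ _ _ es) (order231 _ _ _ et) ab bc.
Qed.

Lemma same_part_swap a b c : a < b -> a < c -> b < c ->
  same_part K_123_231_213_312 [:: b; a; c] [:: c; a; b].
Proof.
move=> ab ac bc; apply/existsP; exists (perms_of_words 3 [:: [:: 2; 1; 3]; [:: 3; 1; 2]]).
rewrite /K_123_231_213_312 !inE eqxx ?orbT /=.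
have [s es] : exists s : 'S_3, word s = [:: 2; 1; 3] by apply: word_surj.
have [t et] : exists t : 'S_3, word t = [:: 3; 1; 2] by apply: word_surj.
apply/existsP; exists s; rewrite !inE es eqxx /=; apply/existsP; exists t.
by rewrite !inE et eqxx orbT (order213 _ _ _ es) (order312 _ _ _ et) ab bc.
Qed.

Lemma eqv_cat u v a b : eqv u v -> eqv (a ++ u ++ b) (a ++ v ++ b).
Proof. by move=> uv; elim: a => [|x a IH] /=; [apply: eqv_catr | apply: eqv_cons]. Qed.

Lemma K_step_eqv n (phi psi : 'S_n) :
  K_step K_123_231_213_312 phi psi -> eqv (word phi) (word psi).
Proof.
case/K_stepP => a [u [v [b [ephi epsi su sv sp]]]]; rewrite ephi epsi.
apply/eqv_cat/same_part_eqv => //.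
have : perm_eq (word phi) (word psi).
  by rewrite (perm_trans (perm_word phi)) // perm_sym perm_word.
by rewrite ephi epsi perm_cat2l perm_cat2r.
Qed.

Lemma move_K_equiv n (phi psi : 'S_n) :
  move (word phi) (word psi) -> K_equiv K_123_231_213_312 phi psi.
Proof.
move=> /moveP[p [a [b [c [s [[ab bc e1 e2]|[ab ac e1 e2]]]]]]].
  apply/connect1/K_stepP; exists p, [:: a; b; c], [:: b; c; a], s; split=> //.
  exact: same_part_rot.
have [bc|cb|bc] := ltngtP b c; last 1 first.
- have -> : phi = psi by apply: word_inj; rewrite e1 e2 bc.
  exact: connect0.
- apply/connect1/K_stepP; exists p, [:: b; a; c], [:: c; a; b], s; split=> //.
  exact: same_part_swap.
apply/connect1/K_stepP; exists p, [:: b; a; c], [:: c; a; b], s; split=> //.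
by rewrite same_part_sym same_part_swap.
Qed.

Lemma K_equivP n (phi psi : 'S_n) :
  reflect (eqv (word phi) (word psi)) (K_equiv K_123_231_213_312 phi psi).
Proof.
apply: (iffP idP).
  case/connectP => p; elim: p phi => [|chi p IH] phi /=; first by move=> _ ->; apply: EqvRefl.
  by case/andP=> /K_step_eqv h /IH{}IH /IH; apply: eqv_trans.
suff H w1 w2 : eqv w1 w2 -> forall phi psi : 'S_n, word phi = w1 -> word psi = w2 ->
    K_equiv K_123_231_213_312 phi psi by move=> /H; apply.
have K_sym : symmetric (K_equiv K_123_231_213_312 (n := n)).
  exact: sym_connect_sym (@K_step_sym _ _ _).
have lift u v (chi : 'S_n) : perm_eq u v -> word chi = u -> exists chi' : 'S_n, word chi' = v.
  move=> uv ec; rewrite -ec perm_sym in uv; apply: word_surj.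
  exact: perm_trans uv (perm_word _).
elim=> {w1 w2 phi psi} [w | u v w uv _ IH | u v w uv _ IH] phi psi e1 e2.
- by have -> : phi = psi; [apply: word_inj; rewrite e1 | apply: connect0].
- have [chi ec] := lift _ _ _ (move_perm uv) e1.
  by apply: (connect_trans (y := chi)); [apply: move_K_equiv; rewrite e1 ec | apply: IH].
- have vu := move_perm uv; rewrite perm_sym in vu; have [chi ec] := lift _ _ _ vu e1.
  apply: (connect_trans (y := chi)); last exact: IH.
  by rewrite -[connect _ _ _]/(K_equiv _ _ _) K_sym; apply: move_K_equiv; rewrite e1 ec.
Qed.

(** * Counting the classes *)

(** The number of classes is the number of elements of a system of
    representatives. *)
Lemma card_classes (T : finType) (e : rel T) (r : seq T) :
    equivalence_rel e -> uniq r -> {in r &, forall x y, e x y -> x = y} ->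
    (forall x, exists2 y, y \in r & e x y) ->
  #|equivalence_partition e [set: T]| = size r.
Proof.
move=> he ur inj cov.
have -> : equivalence_partition e [set: T] =
    [set [set y in [set: T] | e x y] | x in [set x in r]].
  apply/setP => A; apply/imsetP/imsetP => [[x _ ->]|[x _ ->]]; last by exists x; rewrite ?inE.
  have [y yr exy] := cov x; exists y; rewrite ?inE //.
  by apply/setP => z; rewrite !inE (he x y z).2.
rewrite card_in_imset => [|x y].
  by rewrite cardsE; apply/card_uniqP.
rewrite !inE => xr yr /setP/(_ y); rewrite !inE (he y y y).1 => /(inj x y xr yr) //.
Qed.

(** The valid lists on [1, ..., n.+1] written as words, without the leading letter
    [n.+1]. *)
Definition rot_free_reps n := [seq behead (unparse B) | B <- block_lists n.+1].

Lemma unparse_head n B : B \in block_lists n.+1 ->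
  unparse B = n.+1 :: behead (unparse B).
Proof.
move=> hB; have [/andP[k0 kn] eP] := block_lists_peaks hB.
suff [P [V [r eB]]] : exists P V r, B = (n.+1 :: P, V) :: r.
  by rewrite eB; case: (V).
case: B {hB} k0 kn eP => // -[P V] r; rewrite /num_peaks [next_peaks _]/=.
case: P => // p P _; rewrite [size _]/= => kn; move: (size P) kn => s sn.
rewrite iota_rcons rev_rcons => -[ep _]; exists P, V, r.
by congr ((_ :: _, _) :: _); lia.
Qed.

Lemma rot_free_reps_spec n B : B \in block_lists n.+1 ->
  perm_eq (behead (unparse B)) (iota 1 n) /\ rot_free (behead (unparse B)).
Proof.
move=> hB; have [vB pB _] := block_lists_spec hB; have eB := blocks_unparse vB.
have uB := unparse_head hB; split.
  have pu : perm_eq (unparse B) (iota 1 n.+1).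
    by apply: perm_trans pB; rewrite perm_sym -{1}eB perm_blocks.
  rewrite uB iota_rcons add1n in pu; rewrite -(perm_cons n.+1) (perm_trans pu) //.
  by rewrite perm_rcons.
by apply: (@rot_free_tail n.+1); rewrite -uB; apply: valid_rot_free; rewrite eB.
Qed.

Lemma rot_free_reps_inj n : {in block_lists n.+1 &, forall B1 B2,
  eqv (behead (unparse B1)) (behead (unparse B2)) -> B1 = B2}.
Proof.
move=> B1 B2 h1 h2 /(eqv_cons n.+1); rewrite -!unparse_head // => h.
have [v1 _ _] := block_lists_spec h1; have [v2 _ _] := block_lists_spec h2.
by rewrite -(blocks_unparse v1) -(blocks_unparse v2) (blocks_eqv h) // blocks_unparse.
Qed.

Lemma rot_free_reps_complete n w : perm_eq w (iota 1 n) -> rot_free w ->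
  exists2 v, v \in rot_free_reps n & eqv w v.
Proof.
move=> pw sw; have uw : uniq w by rewrite (perm_uniq pw) iota_uniq.
have wn : all (gtn n.+1) w by rewrite (perm_all _ pw); apply/allP => x; rewrite mem_iota /=; lia.
have vB := rot_free_valid_top sw uw wn.
exists (behead (unparse (blocks (n.+1 :: w)))).
  apply: map_f; apply: block_lists_complete => //.
  rewrite (perm_trans (perm_blocks _)) // [iota 1 n.+1]iota_rcons add1n.
  by rewrite perm_sym perm_rcons perm_cons perm_sym.
have [aw|aw] := boolP (asc w); last first.
  rewrite blocks_desc //=; apply: eqv_unparse; exact: valid_tail_desc vB.
case: w pw sw uw wn vB aw => // v w pw sw uw wn vB aw.
have vw := valid_tail_asc aw vB.
case: w pw sw uw wn vB aw vw => // q w pw sw uw wn vB aw vw.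
rewrite blocks_asc //; have [P [V [r [e _]]]] := blocks_cons q w.
have e' := eqv_unparse vw; rewrite e in e' *.
have sP : sorted gtn P by move: vw; rewrite e => /andP[].
have Pn : all (gtn n.+1) P.
  apply/allP => x xP; apply: (allP wn); rewrite inE -(perm_mem (perm_blocks (q :: w))) e.
  by rewrite mem_letters xP orbT.
by rewrite /push sort_geq_id /= ?(path_min_sorted Pn) //; apply: eqv_cons.
Qed.

Definition reps n := rot_reps n ++ rot_free_reps n.

Lemma mem_reps n w : (w \in reps n) = (w \in rot_reps n) || (w \in rot_free_reps n).
Proof. exact: mem_cat. Qed.

Lemma reps_perm n w : w \in reps n -> perm_eq w (iota 1 n).
Proof.
by rewrite mem_reps => /orP[/rot_reps_perm//|/mapP[B /rot_free_reps_spec[h _] ->]].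
Qed.

Lemma reps_disjoint n u v : u \in rot_reps n -> v \in rot_free_reps n -> ~ eqv v u.
Proof.
by move=> /rot_reps_has_rot bu /mapP[B /rot_free_reps_spec[_ sv] ->] /sv; rewrite bu.
Qed.

Lemma reps_inj n : {in reps n &, forall u v, eqv u v -> u = v}.
Proof.
move=> u v; rewrite !mem_reps => /orP[hu|hu] /orP[hv|hv] h.
- exact (rot_reps_inj hu hv h).
- by case: (reps_disjoint hu hv (eqv_sym h)).
- by case: (reps_disjoint hv hu h).
- by case/mapP: hu h => B1 h1 ->; case/mapP: hv => B2 h2 -> /(rot_free_reps_inj h1 h2) ->.
Qed.

Lemma reps_uniq n : uniq (reps n).
Proof.
rewrite cat_uniq rot_reps_uniq andTb; apply/andP; split.
  by apply/hasPn => w hw; apply/negP => hw'; case: (reps_disjoint hw' hw (EqvRefl w)).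
rewrite map_inj_in_uniq ?block_lists_uniq // => B1 B2 h1 h2 e.
have := EqvRefl (behead (unparse B1)); rewrite {2}e; exact: (rot_free_reps_inj h1 h2).
Qed.

Lemma size_reps n : 1 < n ->
  size (reps n) = \sum_(1 <= k < (n %/ 2 + 1).+1) g n.+1 k + (n - 2).
Proof.
move=> n1; rewrite size_cat size_rot_reps // size_map size_block_lists_g 1?addnC //.
exact: ltnW.
Qed.

Theorem proposition3p83 (n : nat) (hn : 3 <= n) :
  num_K_classes K_123_231_213_312 n =
    \sum_(1 <= k < (n %/ 2 + 1).+1) g n.+1 k + (n - 2).
Proof.
(* The representatives are carried over to permutations. *)
rewrite -size_reps; last exact: ltnW.
pose r := [seq s <- enum 'S_n | word s \in reps n].
have mr (s : 'S_n) : (s \in r) = (word s \in reps n) by rewrite mem_filter mem_enum andbT.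
have -> : size (reps n) = size r.
  rewrite -(size_map (@word n) r); apply/perm_size/uniq_perm => [||w].
  - exact: reps_uniq.
  - by rewrite (map_inj_uniq (@word_inj n)) filter_uniq // enum_uniq.
  apply/idP/mapP => [hw|[s + ->]]; last by rewrite mr.
  have [s es] := word_surj (reps_perm hw); exists s => //.
  by rewrite mr es.
apply: card_classes.
- exact: K_equiv_equivalence.
- by rewrite filter_uniq // enum_uniq.
- move=> s t; rewrite !mr => hs ht /K_equivP h; apply: word_inj; exact: (reps_inj hs ht h).
move=> phi; suff [w hw pw] : exists2 w, w \in reps n & eqv (word phi) w.
  have [s es] := word_surj (reps_perm hw); exists s; first by rewrite mr es.
  by apply/K_equivP; rewrite es.
(* Either some member of the class of [phi] has a rotatable window, or none
   does. *)
have [/existsP[psi /andP[/K_equivP e bad]]|/existsPn nobad] :=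
    boolP [exists psi, K_equiv K_123_231_213_312 phi psi && has_rot (word psi)].
  have [w hw ew] := rot_reps_complete (perm_word psi) bad.
  by exists w; [rewrite mem_reps hw | apply: eqv_trans e ew].
have sm : rot_free (word phi).
  move=> v hv; have [|psi epsi] := @word_surj n v.
    by apply: perm_trans (perm_word phi); rewrite perm_sym eqv_perm.
  have := nobad psi; rewrite epsi; have -> // : K_equiv K_123_231_213_312 phi psi.
  by apply/K_equivP; rewrite epsi.
have [w hw ew] := rot_free_reps_complete (perm_word phi) sm.
by exists w => //; rewrite mem_reps hw orbT.
Qed.
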